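(* Fix a dimension $d\ge 1$, a finite totally ordered spin set $S$, a number $M$ and a mixing tolerance $\varepsilon\in(0,1)$. Let $\ell\ge1$ and $N\ge 1$ be integers with $(\ell+1)\mid N$, let $V=[0,N-1]^d$ be the $d$-dimensional toroidal grid, and let $\Omega\subseteq S^V$ be the configuration space of a monotone Markov random field $\langle\Omega,S,V,\pi\rangle$ on $V$ having a top and a bottom configuration. For each $v\in V$ let $B_v$ be the cube of side-length $\ell$ anchored at $v$. If the block dynamics determined by $\mathcal{B}=\{B_v: v\in V\}$ is contracting with constant $\gamma>0$, and the single-site dynamics restricted to any block has mixing time at most $M$ for all boundary conditions, then the single-site Glauber dynamics on all of $V$ has mixing time $T(\varepsilon)=O(|V|\log|V|)$, where the implied constant depends only on $\gamma$ and on $\ell$ (the data $d,S,M,\varepsilon$ being fixed); in particular it does not depend on $N$.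
   Context: A system $\langle \Omega,S,V,\pi\rangle$ consists of a finite set $S$ of spins, a finite set $V$ of sites, a set $\Omega\subseteq S^V$ of configurations, and a probability distribution $\pi$ on $\Omega$ with $\pi(\omega)>0$ for all $\omega\in\Omega$ (extended by $0$ to $S^V\setminus\Omega$). For $\sigma\in\Omega$, $v\in V$, $s\in S$, $\sigma_v^s$ is $\sigma$ with its value at $v$ changed to $s$, and $\sigma_v^\bullet=\{\sigma_v^s:s\in S\}\cap\Omega$. For $B\subseteq V$, $\sigma_B^\bullet$ is the set of $\tau\in\Omega$ agreeing with $\sigma$ on $V\setminus B$, and the block update $U_B\sigma$ is $\pi$ conditioned on $\sigma_B^\bullet$, i.e. $(U_B\sigma)(\omega)=\pi(\omega)/\pi(\sigma_B^\bullet)$ for $\omega\in\sigma_B^\bullet$. The system is monotone if $S$ is totally ordered, $S^V$ has the coordinatewise order, and whenever $\sigma\le\tau$ in $\Omega$, for every $v\in V$ the distribution $\{\pi(\sigma_v^s)/\pi(\sigma_v^\bullet)\}_{s\in S}$ on $S$ is stochastically dominated by $\{\pi(\tau_v^s)/\pi(\tau_v^\bullet)\}_{s\in S}$. Top/bottom configuration means greatest/least element of $\Omega$. In the toroidal grid, two vertices are adjacent if they differ by $\pm1$ modulo $N$ in exactly one coordinate and agree in the others. The system is a Markov random field if for every $B\subset V$ and $\sigma\in\Omega$, the law of the configuration on $B$ under $U_B\sigma$ depends only on the restriction of $\sigma$ to $\partial B$, the set of vertices of $V\setminus B$ adjacent to $B$. The cube anchored at $v$ is $B_v=v+\{0,\dots,\ell-1\}^d$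 with coordinates taken modulo $N$. The block dynamics determined by $\mathcal{B}$ selects at each step a block $B\in\mathcal{B}$ uniformly at random and replaces the current $\sigma$ by a sample from $U_B\sigma$. Let $H(\sigma,\tau)=|\{v:\sigma_v\ne\tau_v\}|$ and let $\rho(\mu,\nu)$ be the minimum of $\mathbf{E}H(\sigma,\tau)$ over all couplings of $\sigma\sim\mu$ and $\tau\sim\nu$ (Kantorovich distance). The block dynamics is contracting with constant $\gamma>0$ if for any two configurations $\sigma,\tau\in\Omega$ the expected number of discrepancies after a block update is smaller by a factor of $1-\gamma|B|/|V|$ or less: $$\frac1{|\mathcal B|}\sum_{B\in\mathcal B}\rho(U_B\sigma,U_B\tau)\le\Bigl(1-\gamma\frac{\ell^d}{|V|}\Bigr)H(\sigma,\tau).$$ Single-site Glauber dynamics on $V$: at each discrete step a uniformly random site $v\in V$ is chosen and $\sigma$ is replaced by a sample from $\pi$ conditioned on $\sigma_v^\bullet$. Its mixing time $T(\varepsilon)$ is the least $t$ such that from every starting state $\omega\in\Omega$ the law after $t$ steps is within total variation distance $\varepsilon$ of $\pi$. Single-site dynamics restricted to a block $B$ with boundary condition given by $\omega\in\Omega$ is the same dynamics with sites chosen uniformly from $B$, on state space $\omega_B^\bullet$ with stationary distribution $U_B\omega$; its mixing time is the least $t$ such that from every starting state in $\omega_B^\bullet$ the law after $t$ steps is within total variation distance $1/4$ of $U_B\omega$. *)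

(* Defs.v *)
From mathcomp Require Import all_boot all_order all_algebra.
From mathcomp Require Import boolp classical_sets reals exp.

Set Implicit Arguments.
Unset Strict Implicit.
Unset Printing Implicit Defensive.

Import Order.TTheory GRing.Theory Num.Theory.
Local Open Scope ring_scope.

Notation config V S := {ffun V -> S}.

(* The set Omega and the distribution pi on it, extended by 0 to S^V. *)
Record spin_system (R : realType) (V S : finType) := SpinSystem {
  conf : {set config V S};
  prob : config V S -> R;
  prob_gt0 : forall w, w \in conf -> 0 < prob w;
  prob_out : forall w, w \notin conf -> prob w = 0;
  prob_sum1 : \sum_w prob w = 1
}.

Section FiniteDistributions.
Variables (R : realType) (T : finType).
Implicit Types mu nu : T -> R.

Definition mass mu (A : {set T}) : R := \sum_(x in A) mu x.

Definition condition mu (A : {set T}) (x : T) : R :=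
  if x \in A then mu x / mass mu A else 0.

Definition tv_dist mu nu : R := 2^-1 * \sum_x `|mu x - nu x|.

Definition is_coupling mu nu (q : T * T -> R) : Prop :=
  [/\ forall z, 0 <= q z,
      forall x, \sum_y q (x, y) = mu x &
      forall y, \sum_x q (x, y) = nu y].

(* [law K x t] is the law after [t] steps of the chain with transition
   probabilities [K x y] (from x to y) started at [x]. *)
Fixpoint law (K : T -> T -> R) (x : T) (t : nat) : T -> R :=
  if t is t'.+1 then fun y => \sum_z law K x t' z * K z y
  else fun y => (x == y)%:R.

Definition mixed (K : T -> T -> R) (A : {set T}) mu (eps : R) (t : nat) : Prop :=
  forall x, x \in A -> tv_dist (law K x t) mu <= eps.

(* A relation rather than a function, as a chain need not mix at all. *)
Definition is_mixing_time K (A : {set T}) mu (eps : R) (t : nat) : Prop :=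
  mixed K A mu eps t /\ forall t', mixed K A mu eps t' -> (t <= t')%N.

End FiniteDistributions.

Definition stoch_le (R : realType) (disp : Order.disp_t) (S : finOrderType disp)
    (p q : S -> R) : Prop :=
  forall A : {set S},
    (forall x y, x \in A -> (x <= y)%O -> y \in A) -> mass p A <= mass q A.

Section Configurations.
Variables V S : finType.
Implicit Types s t : config V S.

Definition upd s (v : V) (a : S) : config V S :=
  [ffun u => if u == v then a else s u].

Definition hamming s t : nat := #|[set v | s v != t v]|.

End Configurations.

Definition conf_le (V : finType) (disp : Order.disp_t) (S : finOrderType disp)
    (s t : config V S) : bool := [forall v, (s v <= t v)%O].

(* Kantorovich distance for the Hamming metric; for probability distributions
   the couplings form a nonempty compact set, so this infimum is a minimum. *)
Definition kantorovich (R : realType) (V S : finType)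
    (mu nu : config V S -> R) : R :=
  inf [set r : R | exists q : config V S * config V S -> R,
         is_coupling mu nu q /\
         r = \sum_z q z * (hamming z.1 z.2)%:R]%classic.

Section Dynamics.
Variables (R : realType) (V S : finType) (sys : spin_system R V S).
Implicit Types (s t w : config V S) (B : {set V}).

Definition site_fiber s (v : V) : {set config V S} :=
  [set upd s v a | a : S] :&: conf sys.

Definition block_fiber s B : {set config V S} :=
  [set t in conf sys | [forall v in ~: B, t v == s v]].

Definition site_update (v : V) s : config V S -> R :=
  condition (prob sys) (site_fiber s v).

Definition block_update B s : config V S -> R :=
  condition (prob sys) (block_fiber s B).

Definition spin_law s (v : V) (a : S) : R :=
  prob sys (upd s v a) / mass (prob sys) (site_fiber s v).

Definition glauber_on B s w : R :=
  #|B|%:R^-1 * \sum_(v in B) site_update v s w.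

Definition glauber : config V S -> config V S -> R := glauber_on [set: V].

Definition glauber_mixing_time (eps : R) (t : nat) : Prop :=
  is_mixing_time glauber (conf sys) (prob sys) eps t.

Definition block_mixing_time B w (t : nat) : Prop :=
  is_mixing_time (glauber_on B) (block_fiber w B) (block_update B w) 4^-1 t.

Definition boundary (e : rel V) B : {set V} :=
  [set v in ~: B | [exists u in B, e u v]].

(* Probability that a sample from [block_update B s] agrees with the pattern
   [eta] on [B]; the values of [eta] off [B] are irrelevant. *)
Definition block_marginal B s (eta : config V S) : R :=
  \sum_(w : config V S | [forall v in B, w v == eta v]) block_update B s w.

Definition markov_random_field (e : rel V) : Prop :=
  forall B s t, s \in conf sys -> t \in conf sys ->
    (forall v, v \in boundary e B -> s v = t v) ->
    forall eta, block_marginal B s eta = block_marginal B t eta.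

End Dynamics.

Section OrderedSpins.
Variables (R : realType) (V : finType).
Variables (disp : Order.disp_t) (S : finOrderType disp).
Variable sys : spin_system R V S.

Definition monotone_system : Prop :=
  forall s t, s \in conf sys -> t \in conf sys -> conf_le s t ->
    forall v, stoch_le (spin_law sys s v) (spin_law sys t v).

Definition has_top_conf : Prop :=
  exists2 t, t \in conf sys & forall s, s \in conf sys -> conf_le s t.

Definition has_bottom_conf : Prop :=
  exists2 b, b \in conf sys & forall s, s \in conf sys -> conf_le b s.

End OrderedSpins.

Definition torus (d N : nat) : finType := {ffun 'I_d -> 'I_N}.

Definition torus_adj (d N : nat) : rel (torus d N) := fun u v =>
  [exists i, ((u i == (v i).+1 %[mod N]) || (v i == (u i).+1 %[mod N]))
             && [forall j, (j != i) ==> (u j == v j)]].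

Definition cube (d N l : nat) (v : torus d N) : {set torus d N} :=
  [set u : torus d N | [forall i, exists k : 'I_l, u i == v i + k %[mod N]]].

Definition cubes (d N l : nat) : {set {set torus d N}} :=
  [set cube l v | v : torus d N].

Definition block_contracting (R : realType) (d N l : nat) (S : finType)
    (sys : spin_system R (torus d N) S) (gamma : R) : Prop :=
  forall s t, s \in conf sys -> t \in conf sys ->
    #|cubes d N l|%:R^-1 *
      \sum_(B in cubes d N l)
         kantorovich (block_update sys B s) (block_update sys B t)
    <= (1 - gamma * ((l ^ d)%:R / #|torus d N|%:R)) * (hamming s t)%:R.

(* Main.v *)
(** Monotonicity makes every single-site update a self-adjoint operator on
    L^2(pi) that preserves increasing functions, and Chebyshev's inequality on
    the chain S gives <g, K_v h> <= <g, h> for increasing g and h.  Taking for g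
    the indicator of the top configuration (minus that of the bottom one),
    omitting updates can only enlarge the gap between the top and bottom
    expectations of an increasing function: this is the Peres-Winkler censoring
    inequality.  For f the sum of the ranks of all spins, f + g and f - g are
    increasing for every g with values in [0, 1], so the gap of f controls the
    total variation distance.

    The gap is estimated for the following censored dynamics: in each round of
    O(|V|) steps only the sites of a uniformly random translate of a lattice of
    cubes, any two of which are non-adjacent, are updated.  By the Markov
    property the updates in distinct cubes commute, so a round applies to each
    cube a random number of steps of its own dynamics, which typically brings it
    close to a block update.  Averaging over translates, contraction of the
    block dynamics shows that a round multiplies Lipschitz constants for the
    Hamming distance by a factor bounded away from 1, and O(log |V|) rounds
    suffice. *)
Require Import Defs.
From mathcomp Require Import all_boot all_order all_algebra.
From mathcomp Require Import reals exp.
From mathcomp Require Import boolp classical_sets sequences.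
From mathcomp Require Import ring lra.

Set Implicit Arguments.
Unset Strict Implicit.
Unset Printing Implicit Defensive.

Import Order.TTheory GRing.Theory Num.Theory.
Local Open Scope ring_scope.

(** * Single-site updates *)

Section SiteOperator.
Variables (R : realType) (V S : finType) (sys : spin_system R V S).
Implicit Types (s t w : config V S) (g h : config V S -> R) (v : V) (B : {set V}).

Local Notation Om := (conf sys).
Local Notation pi := (prob sys).

(** The heat-bath update at [v] acting on observables. Inadmissible spins carry weight 0, so values
    of [h] off Omega never count. *)
Definition site_op v h s : R := \sum_a spin_law sys s v a * h (upd s v a).

Definition inner g h : R := \sum_s pi s * (g s * h s).

Lemma prob_ge0 s : 0 <= pi s.
Proof.
case: (boolP (s \in Om)) => [/(prob_gt0 (s := sys))/ltW //|].
by move=> /prob_out ->.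
Qed.

Lemma updE s v a u : upd s v a u = if u == v then a else s u.
Proof. by rewrite ffunE. Qed.

Lemma upd_upd s v a b : upd (upd s v a) v b = upd s v b.
Proof. by apply/ffunP => u; rewrite !updE; case: eqP. Qed.

Lemma upd_id s v : upd s v (s v) = s.
Proof. by apply/ffunP => u; rewrite !updE; case: eqP => // ->. Qed.

Lemma upd_inj s v : injective (upd s v).
Proof. by move=> a b /ffunP/(_ v); rewrite !updE eqxx. Qed.

Lemma site_fiberE s v w :
  (w \in site_fiber sys s v) = (w \in Om) && (w == upd s v (w v)).
Proof.
apply/idP/idP => [|/andP[wO /eqP wE]].
  rewrite inE => /andP[/imsetP[a _ ->] ->] /=.
  by rewrite updE eqxx.
by rewrite inE wO andbT wE imset_f.
Qed.

Lemma site_fiber_upd s v a : site_fiber sys (upd s v a) v = site_fiber sys s v.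
Proof. by apply/setP => w; rewrite !site_fiberE upd_upd. Qed.

Lemma site_fiber_sum s v (F : config V S -> R) :
  (forall w, w \notin Om -> F w = 0) ->
  \sum_(w in site_fiber sys s v) F w = \sum_a F (upd s v a).
Proof.
move=> F0.
rewrite -(big_imset (h := upd s v) F (A := predT)) /=; last first.
  by move=> a b _ _; apply: upd_inj.
rewrite [RHS](bigID (mem Om)) /= [X in _ + X]big1 ?addr0; last first.
  by move=> w /andP[_ /F0].
by apply: eq_bigl => w; rewrite inE; congr (_ && _).
Qed.

Lemma mass_site_fiber s v : mass pi (site_fiber sys s v) = \sum_a pi (upd s v a).
Proof. by apply: site_fiber_sum => w /prob_out. Qed.

Lemma site_mass_gt0 s v : s \in Om -> 0 < mass pi (site_fiber sys s v).
Proof.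
move=> sO; rewrite mass_site_fiber (bigD1 (s v)) //= upd_id.
by rewrite ltr_pwDl ?prob_gt0 // sumr_ge0 // => *; exact: prob_ge0.
Qed.

Lemma spin_law_ge0 s v a : 0 <= spin_law sys s v a.
Proof.
rewrite /spin_law divr_ge0 ?prob_ge0 // mass_site_fiber sumr_ge0 // => *.
exact: prob_ge0.
Qed.

Lemma spin_law_sum s v : s \in Om -> \sum_a spin_law sys s v a = 1.
Proof.
move=> sO; rewrite -mulr_suml -mass_site_fiber divff //.
by rewrite gt_eqF ?site_mass_gt0.
Qed.

Lemma spin_law_out s v a : upd s v a \notin Om -> spin_law sys s v a = 0.
Proof. by move=> /prob_out; rewrite /spin_law => ->; rewrite mul0r. Qed.

Lemma site_opE v h s : site_op v h s = \sum_w site_update sys v s w * h w.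
Proof.
rewrite /site_update /condition.
under eq_bigr => w _.
  rewrite (_ : (if _ then _ else _) * _ =
    if w \in site_fiber sys s v
    then pi w / mass pi (site_fiber sys s v) * h w else 0); last first.
    by case: ifP; rewrite ?mul0r.
  over.
rewrite -big_mkcond site_fiber_sum //.
by move=> w /prob_out ->; rewrite !mul0r.
Qed.

Lemma eq_site_op v g h s : {in Om, g =1 h} -> site_op v g s = site_op v h s.
Proof.
move=> gh; apply: eq_bigr => a _.
have [uO|/spin_law_out->] := boolP (upd s v a \in Om); last by rewrite !mul0r.
by rewrite gh.
Qed.

(** Detailed balance: configurations differing only at [v] have the same fiber, hence the same
    normalising mass. *)
Lemma site_update_sym v s w :
  pi s * site_update sys v s w = pi w * site_update sys v w s.
Proof.
rewrite /site_update /condition.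
have [sO|/prob_out s0] := boolP (s \in Om); last first.
  by rewrite s0 !mul0r; case: ifP; rewrite ?mulr0 // mulr0.
have [wO|/prob_out w0] := boolP (w \in Om); last first.
  by rewrite w0 !mul0r; case: ifP; rewrite ?mulr0 // mulr0.
rewrite !site_fiberE sO wO /=.
have E : (w == upd s v (w v)) = (s == upd w v (s v)).
  by apply/eqP/eqP => {1}->; rewrite upd_upd upd_id.
rewrite -E; case: eqP => [->|]; last by rewrite !mulr0.
by rewrite site_fiber_upd mulrCA.
Qed.

Lemma site_op_sym v g h : inner (site_op v g) h = inner g (site_op v h).
Proof.
rewrite /inner.
under eq_bigr => s _ do rewrite site_opE mulr_suml mulr_sumr.
rewrite exchange_big /=; apply: eq_bigr => s _.
rewrite site_opE !mulr_sumr; apply: eq_bigr => w _.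
rewrite !mulrA site_update_sym -!mulrA; congr (_ * _).
by rewrite mulrCA mulrA mulrC mulrA.
Qed.

Lemma site_op_le v g h s : {in Om, forall w, g w <= h w} ->
  site_op v g s <= site_op v h s.
Proof.
move=> gh; apply: ler_sum => a _.
have [uO|/spin_law_out->] := boolP (upd s v a \in Om); last by rewrite !mul0r.
by rewrite ler_wpM2l ?spin_law_ge0 ?gh.
Qed.

Lemma site_op_cst v c s : s \in Om -> site_op v (fun=> c) s = c.
Proof. by move=> sO; rewrite /site_op -mulr_suml spin_law_sum // mul1r. Qed.

Lemma site_op_sum v (I : Type) (r : seq I) (c : I -> R) (F : I -> config V S -> R) s :
  site_op v (fun w => \sum_(i <- r) c i * F i w) s
  = \sum_(i <- r) c i * site_op v (F i) s.
Proof.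
rewrite /site_op; under eq_bigr => a _ do rewrite mulr_sumr.
rewrite exchange_big; apply: eq_bigr => i _; rewrite mulr_sumr.
by apply: eq_bigr => a _; rewrite mulrCA.
Qed.

End SiteOperator.

(** * Monotone systems *)

(** Summation by parts over the levels of [phi], by induction on the number of points where [phi] is
    not minimal. *)
Lemma sum_superlevel_ge0 (R : realDomainType) (T : finType) (r phi : T -> R) :
  \sum_x r x = 0 -> (forall c, 0 <= \sum_(x | c <= phi x) r x) ->
  0 <= \sum_x r x * phi x.
Proof.
move=> r0.
have [n] := ubnP #|[pred x | [exists y, phi y < phi x]]|.
elim: n phi => // n IH phi; rewrite ltnS => phin rpos.
case: (pickP [pred x | [exists y, phi y < phi x]]) => [x2 x2P|none]; last first.
  case: (pickP (@predT T)) => [x0 _|none0]; last by rewrite big1 // => x; have := none0 x.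
  have cst x : phi x = phi x0.
    have nlt y z : (phi y < phi z) = false.
      by apply/negP => lt; have /= /negP[] := negbT (none z); apply/existsP; exists y.
    by apply/eqP; rewrite eq_le !leNgt !nlt.
  by under eq_bigr => x _ do rewrite cst; rewrite -mulr_suml r0 mul0r.
have [x1 x1P x1min] := arg_minP phi x2P.
have /existsP[x0' x0'P] := x1P.
have x0P' : predT x0' by [].
have [x0 _ x0min] := arg_minP phi x0P'.
have lt01 : phi x0 < phi x1 by apply: le_lt_trans x0'P; exact: x0min.
have low x : phi x < phi x1 -> phi x = phi x0.
  move=> lt; apply/eqP; rewrite eq_le x0min // andbT leNgt; apply/negP => lt0.
  have := x1min x; rewrite leNgt lt => H.
  by suff: ~~ true by []; apply: H; apply/existsP; exists x0.
(* The lowest level is raised to the second lowest one, [phi x1]. As [r] has total mass 0, its mass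
   below [phi x1] is minus its mass on the superlevel set. *)
pose phi' x := Num.max (phi x) (phi x1).
have E : \sum_x r x * phi x = \sum_x r x * phi' x
    + (phi x1 - phi x0) * \sum_(x | phi x1 <= phi x) r x.
  have -> : \sum_(x | phi x1 <= phi x) r x = - \sum_(x | phi x < phi x1) r x.
    have := r0; rewrite (bigID (fun x => phi x1 <= phi x)) /= => /eqP.
    rewrite addr_eq0 => /eqP ->; congr (- _).
    by apply: eq_bigl => x; rewrite ltNge.
  rewrite mulrN mulr_sumr [X in _ - X]big_mkcond /= -sumrB.
  apply: eq_bigr => x _; rewrite /phi' maxC /Num.max.
  case: ltP => [lt|le].
    by rewrite ltNge (ltW lt) /= subr0.
  move: le; rewrite le_eqVlt => /orP[/eqP->|lt]; first by rewrite ltxx subr0.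
  by rewrite lt (low _ lt); ring.
rewrite E addr_ge0 // ?mulr_ge0 ?subr_ge0 ?(ltW lt01) //.
apply: IH => [|c].
  apply: leq_trans phin; apply: proper_card; apply/properP; split.
    apply/fintype.subsetP => x; rewrite !inE => /existsP[y]; rewrite /phi' => lt.
    apply/existsP; exists x0; move: lt; rewrite gt_max !lt_max.
    case/andP => _; rewrite ltxx orbF => lt; exact: lt_trans lt.
  exists x1; first exact: x1P.
  rewrite !inE; apply/existsP => -[y]; rewrite /phi' maxxx => lt.
  by move: lt; rewrite gt_max ltxx andbF.
have [lec|ltc] := leP c (phi x1).
  rewrite (eq_bigl predT) ?r0 // => x.
  by rewrite /phi' le_max lec orbT.
rewrite (eq_bigl (fun x => c <= phi x)) // => x.
by rewrite /phi' le_max [c <= phi x1]leNgt ltc orbF.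
Qed.

(** Superlevel sets of a nondecreasing [phi] are up-sets, so domination gives the hypothesis of
    [sum_superlevel_ge0] for [q - p]. *)
Lemma stoch_le_sum (R : realType) (disp : Order.disp_t) (S : finOrderType disp)
    (p q : S -> R) (phi : S -> R) :
  stoch_le p q -> \sum_a p a = \sum_a q a ->
  (forall a b, (a <= b)%O -> phi a <= phi b) ->
  \sum_a p a * phi a <= \sum_a q a * phi a.
Proof.
move=> pq pq1 phiM; rewrite -subr_ge0 -sumrB.
under eq_bigr => a _ do rewrite -mulrBl.
apply: sum_superlevel_ge0 => [|c]; first by rewrite sumrB pq1 subrr.
rewrite sumrB subr_ge0.
have massE r : \sum_(x | c <= phi x) r x = mass r [set x | c <= phi x].
  by apply: eq_bigl => x; rewrite inE.
rewrite !massE; apply: pq => a b; rewrite !inE => ca ab.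
exact: le_trans (phiM _ _ ab).
Qed.

Section Monotone.
Variables (R : realType) (V : finType) (disp : Order.disp_t) (S : finOrderType disp).
Variable sys : spin_system R V S.
Implicit Types (s t w : config V S) (g h : config V S -> R) (v : V) (B : {set V}).

Local Notation Om := (conf sys).
Local Notation pi := (prob sys).

Definition increasing h :=
  forall s t, s \in Om -> t \in Om -> conf_le s t -> h s <= h t.

Lemma conf_le_refl s : conf_le s s.
Proof. by apply/forallP. Qed.

Lemma conf_le_trans s t w : conf_le s t -> conf_le t w -> conf_le s w.
Proof.
by move=> /forallP st /forallP tw; apply/forallP => v; apply: le_trans (tw v).
Qed.

(* From comparable configurations, a spin may be admissible at v for one and not
   for the other; increasing functions are therefore extended to all of S^V. *)
Lemma increasing_extension h : increasing h -> exists h' : config V S -> R,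
  {in Om, h =1 h'} /\ forall s t, conf_le s t -> h' s <= h' t.
Proof.
move=> hI.
case: (pickP (mem Om)) => [w0 w0O|none]; last first.
  exists (fun=> 0); split=> // s sO; have := none s.
  by rewrite inE sO.
have [b _ bmin] := arg_minP h w0O.
(* The default [h b] is the minimum of [h] on Omega, so it only matters where no element of Omega
   lies below [s]. *)
exists (fun s => \big[Num.max/h b]_(w in Om | conf_le w s) h w); split.
  move=> s sO; apply/eqP; rewrite eq_le; apply/andP; split.
    by apply: le_bigmax_cond; rewrite sO conf_le_refl.
  apply: bigmax_le => [|w /andP[wO ws]]; first exact: bmin.
  exact: hI.
move=> s t st; apply: sub_bigmax => w /andP[-> ws] /=.
exact: conf_le_trans st.
Qed.

(** First the rest of the configuration is raised under the spin law of [s], then this law is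
    replaced by that of [t]. The intermediate sum may involve [upd t v a] off Omega, whence the
    extension. *)
Lemma site_op_increasing v h : monotone_system sys ->
  increasing h -> increasing (site_op sys v h).
Proof.
move=> mono /increasing_extension[h' [hh' h'M]] s t sO tO st.
rewrite !(eq_site_op _ _ hh').
apply: (@le_trans _ _ (\sum_a spin_law sys s v a * h' (upd t v a))).
  apply: ler_sum => a _; rewrite ler_wpM2l ?spin_law_ge0 // h'M //.
  apply/forallP => u; rewrite !updE; case: eqP => // _.
  exact: (forallP st).
apply: stoch_le_sum; first exact: mono.
  by rewrite !spin_law_sum.
move=> a b ab; apply: h'M; apply/forallP => u; rewrite !updE.
by case: eqP.
Qed.

(** By detailed balance, twice the difference of the two sides is the sum of [pi s * su s w * ((g s
    - g w) * (h s - h w))]. An update at [v] relates comparable configurations, [S] being a chain,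
    so both factors have the same sign. *)
Lemma inner_site_op_le v g h : increasing g -> increasing h ->
  inner sys g (site_op sys v h) <= inner sys g h.
Proof.
move=> gI hI.
pose su := site_update sys v.
have row1 s : pi s * \sum_w su s w = pi s.
  have [sO|/prob_out->] := boolP (s \in Om); last by rewrite mul0r.
  have := site_op_cst v 1 sO; rewrite site_opE /su.
  by under eq_bigr do rewrite mulr1; move=> ->; rewrite mulr1.
have E1 : inner sys g h = \sum_s \sum_w pi s * su s w * (g s * h s).
  apply: eq_bigr => s _; rewrite -mulr_suml; congr (_ * _).
  by rewrite -mulr_sumr row1.
have E2 : inner sys g h = \sum_s \sum_w pi s * su s w * (g w * h w).
  rewrite E1 exchange_big; apply: eq_bigr => s _; apply: eq_bigr => w _.
  by rewrite /su site_update_sym.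
have E3 : inner sys g (site_op sys v h) = \sum_s \sum_w pi s * su s w * (g s * h w).
  apply: eq_bigr => s _; rewrite site_opE mulr_sumr mulr_sumr.
  by apply: eq_bigr => w _; rewrite /su; ring.
have E4 : inner sys g (site_op sys v h) = \sum_s \sum_w pi s * su s w * (g w * h s).
  rewrite E3 exchange_big; apply: eq_bigr => s _; apply: eq_bigr => w _.
  by rewrite /su site_update_sym.
suff : 0 <= (inner sys g h + inner sys g h)
    - (inner sys g (site_op sys v h) + inner sys g (site_op sys v h)) by lra.
rewrite {1}E1 E2 {1}E3 E4 -!big_split /= -sumrB sumr_ge0 // => s _.
rewrite -!big_split /= -sumrB sumr_ge0 // => w _.
have -> : pi s * su s w * (g s * h s) + pi s * su s w * (g w * h w)
   - (pi s * su s w * (g s * h w) + pi s * su s w * (g w * h s))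
   = pi s * su s w * ((g s - g w) * (h s - h w)) by ring.
have [sO|/prob_out->] := boolP (s \in Om); last by rewrite !mul0r.
rewrite /su /site_update /condition.
case: ifP => [|_]; last by rewrite mulr0 mul0r.
rewrite site_fiberE => /andP[wO /eqP wE].
apply: mulr_ge0.
  by rewrite mulr_ge0 ?prob_ge0 // divr_ge0 ?prob_ge0 // ltW ?site_mass_gt0.
have cmp : conf_le s w \/ conf_le w s.
  have [le|le] := orP (le_total (s v) (w v)); [left|right];
    by apply/forallP => u; rewrite wE updE; case: eqP => [->|].
case: cmp => le; last by rewrite mulr_ge0 // subr_ge0; [exact: gI|exact: hI].
by rewrite -mulrNN !opprB mulr_ge0 // subr_ge0; [exact: gI|exact: hI].
Qed.

End Monotone.

(** * Averages of updates and censoring *)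

Section Laws.
Variables (R : realType) (T : finType).
Implicit Types (K : T -> T -> R) (mu nu h : T -> R).

Definition apply_kernel K h x := \sum_y K x y * h y.

Lemma law_iter K x n h :
  \sum_y law K x n y * h y = iter n (apply_kernel K) h x.
Proof.
elim: n h => [|n IH] h /=.
  rewrite (bigD1 x) //= eqxx mul1r big1 ?addr0 // => y /negPf.
  by rewrite eq_sym => ->; rewrite mul0r.
rewrite -iterS iterSr -IH.
under eq_bigr => y _ do rewrite mulr_suml.
rewrite exchange_big; apply: eq_bigr => z _; rewrite mulr_sumr.
by apply: eq_bigr => y _; rewrite mulrA.
Qed.

(** The extremal test function is the indicator of [nu x <= mu x]; equal total masses balance the
    positive and negative parts of [mu - nu]. *)
Lemma tv_dist_le mu nu (D : R) : \sum_x mu x = \sum_x nu x ->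
  (forall g : T -> R, (forall x, 0 <= g x <= 1) ->
     \sum_x mu x * g x - \sum_x nu x * g x <= D) ->
  tv_dist mu nu <= D.
Proof.
move=> mn H; pose g x : R := if nu x <= mu x then 1 else 0.
have /H : forall x, 0 <= g x <= 1.
  by move=> x; rewrite /g; case: ifP; rewrite ?lexx ?ler01.
apply: le_trans; rewrite /tv_dist -sumrB.
under [leRHS]eq_bigr do rewrite -mulrBl.
rewrite -ler_pdivlMl ?invr_gt0 ?ltr0n // invrK -subr_ge0.
have -> : 2 * \sum_x (mu x - nu x) * g x - \sum_x `|mu x - nu x|
  = \sum_x (mu x - nu x).
  rewrite mulr_sumr -sumrB; apply: eq_bigr => x _; rewrite /g.
  case: (leP (nu x) (mu x)) => [le|lt] /=.
    by rewrite ger0_norm ?subr_ge0 //; ring.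
  by rewrite ltr0_norm ?subr_lt0 //; ring.
by rewrite sumrB mn subrr.
Qed.

End Laws.

Section Averages.
Variables (R : realType) (V S : finType) (sys : spin_system R V S).
Implicit Types (s t w : config V S) (g h : config V S -> R) (v : V) (B : {set V}).

Local Notation Om := (conf sys).
Local Notation pi := (prob sys).
Local Notation fn := (config V S -> R).

Definition avg_op (I : finType) (T : I -> fn -> fn) h s : R :=
  #|I|%:R^-1 * \sum_i T i h s.

(** The site is still drawn from all of [V], and a draw off [B] does nothing, so censored and full
    chains share one clock. *)
Definition censored B : fn -> fn :=
  avg_op (fun v => if v \in B then site_op sys v else id).

Definition censoring_scheme (I : finType) (F : I -> {set V}) (k : nat) : fn -> fn :=
  avg_op (fun i => iter k (censored (F i))).

Lemma inner_avg_op (I : finType) (T : I -> fn -> fn) g h :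
  inner sys g (avg_op T h) = #|I|%:R^-1 * \sum_i inner sys g (T i h).
Proof.
rewrite /inner exchange_big mulr_sumr; apply: eq_bigr => s _.
by rewrite /avg_op -!mulr_sumr; ring.
Qed.

Lemma inner_sym g h : inner sys g h = inner sys h g.
Proof. by apply: eq_bigr => s _; rewrite [g s * _]mulrC. Qed.

Lemma avg_op_sym (I : finType) (T : I -> fn -> fn) g h :
  (forall i, inner sys (T i g) h = inner sys g (T i h)) ->
  inner sys (avg_op T g) h = inner sys g (avg_op T h).
Proof.
move=> sym; rewrite inner_sym !inner_avg_op; congr (_ * _).
by apply: eq_bigr => i _; rewrite inner_sym sym.
Qed.

Lemma iter_sym (T : fn -> fn) n :
  (forall g h, inner sys (T g) h = inner sys g (T h)) ->
  forall g h, inner sys (iter n T g) h = inner sys g (iter n T h).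
Proof.
by move=> sym; elim: n => //= n IH g h; rewrite sym IH -!iterS iterSr.
Qed.

Lemma censored_sym B g h :
  inner sys (censored B g) h = inner sys g (censored B h).
Proof. by apply: avg_op_sym => v; case: ifP => // _; exact: site_op_sym. Qed.

Lemma eq_inner g g' h h' : {in Om, g =1 g'} -> {in Om, h =1 h'} ->
  inner sys g h = inner sys g' h'.
Proof.
move=> gg hh; apply: eq_bigr => s _.
have [sO|/prob_out->] := boolP (s \in Om); last by rewrite !mul0r.
by rewrite gg ?hh.
Qed.

Hypothesis V0 : (0 < #|V|)%N.

Lemma avg_cst (I : finType) (c : R) : (0 < #|I|)%N ->
  #|I|%:R^-1 * \sum_(i : I) c = c.
Proof.
by move=> I0; rewrite sumr_const -[c *+ _]mulr_natl mulKf ?pnatr_eq0 -?lt0n.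
Qed.

Lemma censored_cst B c s : s \in Om -> censored B (fun=> c) s = c.
Proof.
move=> sO; rewrite -[RHS](avg_cst c V0); congr (_ * _).
by apply: eq_bigr => v _; case: ifP => // _; rewrite site_op_cst.
Qed.

Lemma censored_le B g h : {in Om, forall w, g w <= h w} ->
  {in Om, forall w, censored B g w <= censored B h w}.
Proof.
move=> gh w wO; rewrite ler_wpM2l ?invr_ge0 ?ler0n //.
apply: ler_sum => v _; case: ifP => // _; first exact: site_op_le.
exact: gh.
Qed.

Lemma eq_censored B g h : {in Om, g =1 h} -> {in Om, censored B g =1 censored B h}.
Proof.
by move=> gh s sO; apply/eqP; rewrite eq_le !censored_le // => w wO; rewrite gh.
Qed.

Lemma censoredD B g h s :
  censored B (fun w => g w + h w) s = censored B g s + censored B h s.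
Proof.
rewrite -mulrDr -big_split; congr (_ * _); apply: eq_bigr => v _ /=.
case: ifP => // _; rewrite /site_op -big_split.
by apply: eq_bigr => a _; rewrite mulrDr.
Qed.

Lemma censoredZ B c h s :
  censored B (fun w => c * h w) s = c * censored B h s.
Proof.
rewrite /censored /avg_op mulrCA; congr (_ * _).
rewrite mulr_sumr; apply: eq_bigr => v _ /=.
case: ifP => // _; rewrite /site_op mulr_sumr.
by apply: eq_bigr => a _; rewrite mulrCA.
Qed.

Lemma eq_iter_censored B n g h : {in Om, g =1 h} ->
  {in Om, iter n (censored B) g =1 iter n (censored B) h}.
Proof. by move=> gh; elim: n => //= n IH; apply: eq_censored. Qed.

Lemma apply_glauber : apply_kernel (glauber sys) = censored [set: V].
Proof.
apply/funext => h; apply/funext => s; rewrite /apply_kernel /glauber /glauber_on.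
under eq_bigr => w _ do rewrite -mulrA mulr_suml.
rewrite -mulr_sumr exchange_big /censored /avg_op cardsT; congr (_ * _).
under eq_bigl do rewrite finset.in_setT.
by apply: eq_bigr => v _; rewrite finset.in_setT site_opE.
Qed.

(** Self-adjointness moves the iterates onto the constant function 1, which they fix. *)
Lemma glauber_stationary n h :
  \sum_s pi s * iter n (censored [set: V]) h s = \sum_s pi s * h s.
Proof.
pose one s : R := 1.
have E k : \sum_s pi s * k s = inner sys one k.
  by apply: eq_bigr => s _; rewrite mul1r.
rewrite !E -iter_sym; last exact: censored_sym.
apply: eq_inner => // s sO; elim: n s sO => //= n IH s sO.
by rewrite (eq_censored _ IH) // censored_cst.
Qed.

(** By stationarity the [pi]-mean of [g] is that of its [n]-step expectation, so bounding
    differences of this expectation between two starting points is enough. *)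
Lemma glauber_tv_dist s n (D : R) : s \in Om ->
  (forall g, (forall w, 0 <= g w <= 1) -> forall t, t \in Om ->
     iter n (censored [set: V]) g s - iter n (censored [set: V]) g t <= D) ->
  tv_dist (law (glauber sys) s n) pi <= D.
Proof.
move=> sO H; apply: tv_dist_le => [|g g01].
  have := law_iter (glauber sys) s n (fun=> 1).
  under eq_bigr do rewrite mulr1; move=> ->; rewrite prob_sum1 apply_glauber.
  elim: n s sO {H} => //= n IH s sO.
  by rewrite (@eq_censored _ _ (fun=> 1) IH) ?censored_cst.
rewrite law_iter apply_glauber -(glauber_stationary n g).
set Pg := iter _ _ g.
have -> : Pg s - \sum_t pi t * Pg t = \sum_t pi t * (Pg s - Pg t).
  by under [RHS]eq_bigr do rewrite mulrBr; rewrite sumrB -mulr_suml prob_sum1 mul1r.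
rewrite -[leRHS]mul1r -(prob_sum1 sys) mulr_suml; apply: ler_sum => t _.
have [tO|/prob_out->] := boolP (t \in Om); last by rewrite !mul0r.
by rewrite ler_wpM2l ?prob_ge0 // H.
Qed.

End Averages.

(** * The censoring inequality *)

Section Censoring.
Variables (R : realType) (V : finType) (disp : Order.disp_t) (S : finOrderType disp).
Variable sys : spin_system R V S.
Implicit Types (s t w : config V S) (g h : config V S -> R) (v : V) (B : {set V}).

Local Notation Om := (conf sys).
Local Notation pi := (prob sys).
Local Notation fn := (config V S -> R).
Local Notation increasing := (increasing sys).

Hypothesis V0 : (0 < #|V|)%N.
Hypothesis mono : monotone_system sys.

Lemma avg_op_increasing (I : finType) (T : I -> fn -> fn) h :
  (forall i, increasing (T i h)) -> increasing (avg_op T h).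
Proof.
move=> TI s t sO tO st; rewrite ler_wpM2l ?invr_ge0 ?ler0n //.
by apply: ler_sum => i _; apply: TI.
Qed.

Lemma iter_increasing (T : fn -> fn) n h :
  (forall g, increasing g -> increasing (T g)) -> increasing h ->
  increasing (iter n T h).
Proof. by move=> TI hI; elim: n => //= n; exact: TI. Qed.

Lemma censored_increasing B h : increasing h -> increasing (censored sys B h).
Proof.
move=> hI; apply: avg_op_increasing => v; case: ifP => // _.
exact: site_op_increasing.
Qed.

(** Operators are exchanged one at a time: once the outermost [T1] has become [T2], self-adjointness
    moves it onto [g], which stays increasing. *)
Lemma inner_iter_le (T1 T2 : fn -> fn) :
  (forall h, increasing h -> increasing (T1 h)) ->
  (forall h, increasing h -> increasing (T2 h)) ->
  (forall g h, inner sys (T2 g) h = inner sys g (T2 h)) ->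
  (forall g h, increasing g -> increasing h ->
     inner sys g (T1 h) <= inner sys g (T2 h)) ->
  forall n g h, increasing g -> increasing h ->
    inner sys g (iter n T1 h) <= inner sys g (iter n T2 h).
Proof.
move=> T1I T2I sym le12; elim=> //= n IH g h gI hI.
apply: (le_trans (le12 _ _ gI (iter_increasing _ T1I hI))).
by rewrite -!sym IH //; exact: T2I.
Qed.

Lemma inner_avg_op_ge (I : finType) (T : I -> fn -> fn) g h c :
  (0 < #|I|)%N -> (forall i, c <= inner sys g (T i h)) ->
  c <= inner sys g (avg_op T h).
Proof.
move=> I0 cT; rewrite inner_avg_op -[c](avg_cst c I0).
by rewrite ler_wpM2l ?invr_ge0 ?ler0n //; apply: ler_sum => i _; apply: cT.
Qed.

Lemma inner_censored_le B g h : increasing g -> increasing h ->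
  inner sys g (censored sys [set: V] h) <= inner sys g (censored sys B h).
Proof.
move=> gI hI; rewrite !inner_avg_op ler_wpM2l ?invr_ge0 ?ler0n //.
apply: ler_sum => v _; rewrite finset.in_setT; case: ifP => // _.
exact: inner_site_op_le.
Qed.

Section Scheme.
Variables (I : finType) (F : I -> {set V}) (k : nat).
Hypothesis I0 : (0 < #|I|)%N.

Let A := censoring_scheme sys F k.
Let P := censored sys [set: V].

(** [inner_iter_le] serves twice: over the [r] rounds, and within a round over its [k] steps with
    [F i] held fixed. *)
Lemma inner_scheme_le r g h : increasing g -> increasing h ->
  inner sys g (iter (r * k) P h) <= inner sys g (iter r A h).
Proof.
move=> gI hI; rewrite iterM; apply: inner_iter_le => //.
- by move=> h' h'I; apply: iter_increasing => // *; exact: censored_increasing.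
- move=> h' h'I; apply: avg_op_increasing => i; apply: iter_increasing => //.
  by move=> *; exact: censored_increasing.
- by move=> *; apply: avg_op_sym => i; apply: iter_sym; exact: censored_sym.
move=> g' h' g'I h'I; apply: inner_avg_op_ge => // i.
apply: inner_iter_le => // *; [exact: censored_increasing|exact: censored_increasing
  |exact: censored_sym|exact: inner_censored_le].
Qed.

Lemma conf_le_anti s t : conf_le s t -> conf_le t s -> s = t.
Proof.
move=> /forallP st /forallP ts; apply/ffunP => v; apply/eqP.
by rewrite eq_le st ts.
Qed.

Lemma inner_delta c s h : inner sys (fun w => c * (w == s)%:R) h = c * pi s * h s.
Proof.
rewrite /inner (bigD1 s) //= eqxx mulr1 big1 ?addr0; first by ring.
by move=> w /negPf->; rewrite !(mulr0, mul0r).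
Qed.

Lemma scheme_top_le top r h : top \in Om ->
  (forall s, s \in Om -> conf_le s top) -> increasing h ->
  iter (r * k) P h top <= iter r A h top.
Proof.
move=> topO topP hI; rewrite -(ler_pM2l (prob_gt0 topO)).
have := inner_scheme_le (g := fun w => 1 * (w == top)%:R) r _ hI.
rewrite !inner_delta !mul1r; apply=> s t sO tO st; rewrite !mul1r.
case: eqP st => [-> /conf_le_anti->|_ _]; rewrite ?eqxx //; exact: topP.
Qed.

Lemma scheme_bot_ge bot r h : bot \in Om ->
  (forall s, s \in Om -> conf_le bot s) -> increasing h ->
  iter r A h bot <= iter (r * k) P h bot.
Proof.
move=> botO botP hI; rewrite -(ler_pM2l (prob_gt0 botO)).
have := inner_scheme_le (g := fun w => -1 * (w == bot)%:R) r _ hI.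
rewrite !inner_delta -!mulrA !mulN1r lerN2; apply=> s t sO tO st.
rewrite !mulN1r lerN2; case: (t =P bot) st => [-> /conf_le_anti->|_ _].
- by rewrite eqxx.
- exact: botP.
by rewrite ler0n.
Qed.

End Scheme.

Definition spin_rank (a : S) : nat := #|[set b : S | (b < a)%O]|.

Definition rank_sum s : R := \sum_v (spin_rank (s v))%:R.

Lemma spin_rank_le a b : (a <= b)%O -> (spin_rank a <= spin_rank b)%N.
Proof.
move=> ab; apply: subset_leq_card; apply/fintype.subsetP => c.
by rewrite !inE => /lt_le_trans; apply.
Qed.

Lemma spin_rank_lt a b : (a < b)%O -> (spin_rank a < spin_rank b)%N.
Proof.
move=> ab; apply: proper_card; apply/properP; split.
  by apply/fintype.subsetP => c; rewrite !inE => /lt_trans; apply.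
by exists a; rewrite inE ?ltxx.
Qed.

Lemma rank_sum_le s t : conf_le s t -> rank_sum s <= rank_sum t.
Proof.
by move=> /forallP st; apply: ler_sum => v _; rewrite ler_nat spin_rank_le.
Qed.

Lemma rank_sum_lt s t : conf_le s t -> s != t -> rank_sum s + 1 <= rank_sum t.
Proof.
move=> /forallP st nst.
have [v nv] : exists v, s v != t v.
  apply/existsP; apply: contraNT nst; rewrite negb_exists => /forallP H.
  by apply/eqP/ffunP => v; apply/eqP; rewrite -[_ == _]negbK.
rewrite /rank_sum (bigD1 v) //= [leRHS](bigD1 v) //= addrAC lerD //.
  by rewrite natr1 ler_nat spin_rank_lt // lt_neqAle nv st.
by apply: ler_sum => u _; rewrite ler_nat spin_rank_le.
Qed.

Lemma rank_sum_add_increasing (e : bool) g : (forall w, 0 <= g w <= 1) ->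
  increasing (fun w => rank_sum w + (-1) ^+ e * g w).
Proof.
move=> g01 s t _ _ st; have [->//|nst] := eqVneq s t.
have := rank_sum_lt st nst; have /andP[] := g01 s; have /andP[] := g01 t.
by case: e; rewrite ?expr0 ?expr1; lra.
Qed.

(** The evolved [rank_sum + g] is compared at [s] and [top], the evolved [rank_sum - g] at [t] and
    [top]. Adding cancels [g] at [top] and leaves two gaps of [rank_sum], hence the factor 2. *)
Lemma iter_censored_gap (g : fn) top bot n s t :
  (forall w, 0 <= g w <= 1) ->
  top \in Om -> (forall s, s \in Om -> conf_le s top) ->
  bot \in Om -> (forall s, s \in Om -> conf_le bot s) ->
  s \in Om -> t \in Om ->
  iter n (censored sys [set: V]) g s - iter n (censored sys [set: V]) g t
  <= 2 * (iter n (censored sys [set: V]) rank_sum top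
          - iter n (censored sys [set: V]) rank_sum bot).
Proof.
move=> g01 topO topP botO botP sO tO.
have PE e w : w \in Om ->
    iter n (censored sys [set: V]) (fun w => rank_sum w + (-1) ^+ e * g w) w
    = iter n (censored sys [set: V]) rank_sum w
      + (-1) ^+ e * iter n (censored sys [set: V]) g w.
  move=> wO; elim: n w wO => //= m IH w wO.
  by rewrite (eq_censored _ IH) // censoredD censoredZ.
set P := iter n _ in PE *.
have PI h : increasing h -> increasing (P h).
  by move=> hI; apply: iter_increasing => // *; exact: censored_increasing.
have fI : increasing rank_sum by move=> ? ? _ _; exact: rank_sum_le.
have := PI _ (rank_sum_add_increasing false g01) _ _ sO topO (topP _ sO).
have := PI _ (rank_sum_add_increasing true g01) _ _ tO topO (topP _ tO).
rewrite !PE // expr0 expr1.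
have := PI _ fI _ _ botO sO (botP _ sO).
have := PI _ fI _ _ botO tO (botP _ tO).
lra.
Qed.

End Censoring.

(** * Single-site dynamics in a block *)

Lemma tv_dist_osc (R : realType) (T : finType) (A : {set T}) (mu nu h : T -> R)
    (e c : R) :
  \sum_x mu x = \sum_x nu x ->
  (forall x, x \notin A -> mu x = 0) -> (forall x, x \notin A -> nu x = 0) ->
  0 <= c -> (forall x y, x \in A -> y \in A -> h x - h y <= c) ->
  tv_dist mu nu <= e ->
  `|\sum_x mu x * h x - \sum_x nu x * h x| <= e * c.
Proof.
move=> mn muA nuA c0 hA tve; rewrite -sumrB.
have e0 : 0 <= e.
  by apply: le_trans tve; rewrite mulr_ge0 ?invr_ge0 ?ler0n // sumr_ge0.
under eq_bigr do rewrite -mulrBl.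
case: (pickP (mem A)) => [x0 x0A|none]; last first.
  rewrite big1 ?normr0 ?mulr_ge0 // => x _.
  have nx : x \notin A by have := none x; rewrite inE => ->.
  by rewrite muA ?nuA // subrr mul0r.
have [b bA bmin] := arg_minP h x0A.
(* Centring at mid-range bounds the deviation of [h] by [c / 2], which matches the factor 1/2 in
   [tv_dist]. *)
pose m := h b + c / 2.
have -> : \sum_x (mu x - nu x) * h x = \sum_x (mu x - nu x) * (h x - m).
  under [RHS]eq_bigr do rewrite mulrBr.
  by rewrite [RHS]sumrB -mulr_suml sumrB mn subrr mul0r subr0.
apply: (le_trans (ler_norm_sum _ _ _)).
apply: (@le_trans _ _ (\sum_x `|mu x - nu x| * (c / 2))); last first.
  have := ler_wpM2r c0 tve; rewrite /tv_dist -mulr_suml.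
  by apply: le_trans; rewrite le_eqVlt; apply/orP; left; apply/eqP; field.
apply: ler_sum => x _; rewrite normrM.
have [xA|xA] := boolP (x \in A); last by rewrite muA ?nuA // subrr normr0 !mul0r.
rewrite ler_wpM2l // ler_norml /m.
have := bmin x xA; have := hA x b xA bA.
by move=> *; apply/andP; split; lra.
Qed.

Section BlockChain.
Variables (R : realType) (V S : finType) (sys : spin_system R V S).
Implicit Types (s t w : config V S) (g h : config V S -> R) (v : V) (B C : {set V}).

Local Notation Om := (conf sys).
Local Notation pi := (prob sys).
Local Notation fn := (config V S -> R).

Definition block_glauber B : fn -> fn := fun h s =>
  #|B|%:R^-1 * \sum_(v in B) site_op sys v h s.

Definition block_op B h s : R := \sum_w block_update sys B s w * h w.

Lemma apply_glauber_on B : apply_kernel (glauber_on sys B) = block_glauber B.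
Proof.
apply/funext => h; apply/funext => s; rewrite /apply_kernel /glauber_on.
under eq_bigr => w _ do rewrite -mulrA mulr_suml.
rewrite -mulr_sumr exchange_big; congr (_ * _).
by apply: eq_bigr => v _; rewrite site_opE.
Qed.

Lemma block_fiberP B s w : reflect
  (w \in Om /\ forall v, v \notin B -> w v = s v) (w \in block_fiber sys s B).
Proof.
rewrite inE; apply: (iffP andP) => -[wO H]; split=> //.
  by move=> v vB; have /forall_inP/(_ v) := H; rewrite inE vB => /(_ isT)/eqP.
by apply/forall_inP => v; rewrite inE => /H/eqP.
Qed.

Lemma block_fiber_refl B s : s \in Om -> s \in block_fiber sys s B.
Proof. by move=> sO; apply/block_fiberP. Qed.

Lemma block_fiber_conf B s w : w \in block_fiber sys s B -> w \in Om.
Proof. by move=> /block_fiberP[]. Qed.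

Lemma block_fiber_eq B s w :
  w \in block_fiber sys s B -> block_fiber sys w B = block_fiber sys s B.
Proof.
move=> /block_fiberP[_ ws]; apply/setP => t.
by apply/block_fiberP/block_fiberP => -[tO tw]; split=> // v vB; rewrite tw ?ws.
Qed.

Section FixedBlock.
Variable B : {set V}.
Hypothesis B0 : (0 < #|B|)%N.

Local Notation G := (block_glauber B).

Let avg_B (c : R) : #|B|%:R^-1 * \sum_(v in B) c = c.
Proof.
by rewrite sumr_const -[c *+ _]mulr_natl mulKf ?pnatr_eq0 -?lt0n.
Qed.

Lemma block_glauber_le g h s : s \in Om ->
  {in block_fiber sys s B, forall w, g w <= h w} -> G g s <= G h s.
Proof.
move=> sO gh; rewrite ler_wpM2l ?invr_ge0 ?ler0n //.
apply: ler_sum => v vB; apply: ler_sum => a _.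
have [uO|/spin_law_out->] := boolP (upd s v a \in Om); last by rewrite !mul0r.
rewrite ler_wpM2l ?spin_law_ge0 // gh //; apply/block_fiberP; split=> // u uB.
by rewrite updE; case: eqP uB vB => // -> /negPf->.
Qed.

Lemma block_glauber_cst c s : s \in Om -> G (fun=> c) s = c.
Proof.
move=> sO; rewrite -[RHS](avg_B c); congr (_ * _).
by apply: eq_bigr => v _; rewrite site_op_cst.
Qed.

Lemma iter_block_glauber_le n g h s : s \in Om ->
  {in block_fiber sys s B, forall w, g w <= h w} -> iter n G g s <= iter n G h s.
Proof.
move=> sO gh; have : s \in block_fiber sys s B by exact: block_fiber_refl.
move: {-2}s => s'; elim: n s' => [|n IH] s' s's /=; first exact: gh.
apply: block_glauber_le; first exact: block_fiber_conf s's.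
by rewrite (block_fiber_eq s's).
Qed.

Lemma eq_iter_block_glauber n g h s : s \in Om ->
  {in block_fiber sys s B, g =1 h} -> iter n G g s = iter n G h s.
Proof.
by move=> sO gh; apply/eqP; rewrite eq_le !iter_block_glauber_le // => w ws;
  rewrite gh.
Qed.

Lemma iter_block_glauber_cst n c s : s \in Om -> iter n G (fun=> c) s = c.
Proof.
move=> sO; have : s \in block_fiber sys s B by exact: block_fiber_refl.
move: {-2}s => s'; elim: n s' => [|n IH] s' s's //=.
have s'O := block_fiber_conf s's.
rewrite -[RHS](block_glauber_cst c s'O).
by apply: (@eq_iter_block_glauber 1) => // w; rewrite (block_fiber_eq s's) => /IH.
Qed.

Lemma iter_block_glauberE n h s :
  iter n G h s = \sum_w law (glauber_on sys B) s n w * h w.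
Proof. by rewrite law_iter apply_glauber_on. Qed.

Lemma iter_block_glauberB n g h s :
  iter n G (fun w => g w - h w) s = iter n G g s - iter n G h s.
Proof.
by rewrite !iter_block_glauberE -sumrB; apply: eq_bigr => w _; rewrite mulrBr.
Qed.

Lemma iter_block_glauber_osc n h c s t : s \in Om -> t \in block_fiber sys s B ->
  (forall w w', w \in block_fiber sys s B -> w' \in block_fiber sys s B ->
     h w - h w' <= c) ->
  iter n G h s - iter n G h t <= c.
Proof.
move=> sO ts hc; have tO := block_fiber_conf ts.
rewrite lerBlDl -lerBlDr -[leLHS](iter_block_glauber_cst n _ tO).
apply: iter_block_glauber_le => // w; rewrite (block_fiber_eq ts) => ws.
rewrite lerBlDr -[leRHS](iter_block_glauber_cst n _ sO).
by apply: iter_block_glauber_le => // w' w's; rewrite -lerBlDl hc.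
Qed.

Lemma block_mass_gt0 s : s \in Om -> 0 < mass pi (block_fiber sys s B).
Proof.
move=> sO; rewrite /mass (bigD1 s) ?block_fiber_refl //=.
by rewrite ltr_pwDl ?prob_gt0 // sumr_ge0 // => *; exact: prob_ge0.
Qed.

Lemma block_update_out s w : w \notin block_fiber sys s B ->
  block_update sys B s w = 0.
Proof. by rewrite /block_update /condition => /negPf->. Qed.

Lemma block_update_ge0 s w : s \in Om -> 0 <= block_update sys B s w.
Proof.
move=> sO; rewrite /block_update /condition; case: ifP => // _.
by rewrite divr_ge0 ?prob_ge0 // ltW // block_mass_gt0.
Qed.

Lemma block_opE h s :
  block_op B h s = (mass pi (block_fiber sys s B))^-1
                   * inner sys (fun w => (w \in block_fiber sys s B)%:R) h.
Proof.
rewrite /block_op /inner mulr_sumr; apply: eq_bigr => w _.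
rewrite /block_update /condition; case: ifP => _; last by rewrite !(mul0r, mulr0).
by rewrite mul1r; ring.
Qed.

Lemma block_update_sum s : s \in Om -> \sum_w block_update sys B s w = 1.
Proof.
move=> sO; have := block_opE (fun=> 1) s; rewrite /block_op.
under eq_bigr do rewrite mulr1; move=> ->; rewrite /inner.
under eq_bigr do rewrite mulr1 mulr_natr mulrb.
by rewrite -big_mkcond mulVf // gt_eqF // block_mass_gt0.
Qed.

(** Up to normalisation [block_op] is the inner product with the indicator of the fiber. The
    self-adjoint [G] fixes this indicator, since no update in [B] enters or leaves the fiber. *)
Lemma block_op_stationary n h s : s \in Om -> block_op B (iter n G h) s = block_op B h s.
Proof.
move=> sO; rewrite !block_opE; congr (_ * _).
elim: n => //= n <-; set h' := iter n _ _.
have sym g k : inner sys (G g) k = inner sys g (G k).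
  have E f k' : inner sys f (G k')
      = #|B|%:R^-1 * \sum_(v in B) inner sys f (site_op sys v k').
    rewrite /inner exchange_big mulr_sumr; apply: eq_bigr => w _.
    by rewrite /block_glauber -!mulr_sumr; ring.
  rewrite inner_sym !E; congr (_ * _); apply: eq_bigr => v _.
  by rewrite inner_sym site_op_sym.
rewrite -sym; apply: eq_inner => // w wO.
rewrite -[RHS](block_glauber_cst _ wO).
apply: (@eq_iter_block_glauber 1) => // w' w'w.
have [ws|ws] := boolP (w \in block_fiber sys s B).
  by rewrite -(block_fiber_eq ws) w'w.
case: (boolP (w' \in _)) => // w's; case/negP: ws.
rewrite -(block_fiber_eq w's) (block_fiber_eq w'w).
exact: block_fiber_refl.
Qed.

(** Both starting points are compared with [block_op], each at the cost of a quarter of the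
    oscillation. *)
Lemma mixed_osc n h c s t t' : s \in Om ->
  mixed (glauber_on sys B) (block_fiber sys s B) (block_update sys B s) 4^-1 n ->
  t \in block_fiber sys s B -> t' \in block_fiber sys s B -> 0 <= c ->
  (forall w w', w \in block_fiber sys s B -> w' \in block_fiber sys s B ->
     h w - h w' <= c) ->
  iter n G h t - iter n G h t' <= 2^-1 * c.
Proof.
move=> sO mix ts t's c0 hc.
have sum1 w : w \in Om -> \sum_y law (glauber_on sys B) w n y = 1.
  move=> wO; rewrite -(iter_block_glauber_cst n 1 wO) iter_block_glauberE.
  by under [RHS]eq_bigr do rewrite mulr1.
have law0 w y : w \in block_fiber sys s B -> y \notin block_fiber sys s B ->
    law (glauber_on sys B) w n y = 0.
  move=> ws ys; have wO := block_fiber_conf ws.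
  have : iter n G (fun z => (z == y)%:R) w = 0.
    rewrite -[RHS](iter_block_glauber_cst n _ wO).
    apply: eq_iter_block_glauber => // z; rewrite (block_fiber_eq ws) => zs.
    by case: eqP ys => // <-; rewrite zs.
  rewrite iter_block_glauberE (bigD1 y) //= eqxx mulr1 big1 ?addr0 //.
  by move=> z /negPf->; rewrite mulr0.
have key w : w \in block_fiber sys s B ->
    `|iter n G h w - block_op B h s| <= 4^-1 * c.
  move=> ws; rewrite iter_block_glauberE.
  apply: (@tv_dist_osc _ _ (block_fiber sys s B)) => //; last exact: mix.
  - by rewrite sum1 ?block_update_sum //; exact: block_fiber_conf ws.
  - by move=> y; exact: law0.
  by move=> y; exact: block_update_out.
have := key _ ts; have := key _ t's.
rewrite !ler_norml => /andP[] ? ? /andP[] ? ?; lra.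
Qed.

(* The rate 1 - 1 / (2m) is chosen so that its m-th power is at least 1/2, by
   Bernoulli's inequality. *)
Lemma block_osc_decay (m : nat) h c s : s \in Om -> 0 <= c -> (0 < m)%N ->
  (exists2 n, (n <= m)%N & mixed (glauber_on sys B) (block_fiber sys s B)
     (block_update sys B s) 4^-1 n) ->
  (forall w w', w \in block_fiber sys s B -> w' \in block_fiber sys s B ->
     h w - h w' <= c) ->
  forall n, forall w w', w \in block_fiber sys s B -> w' \in block_fiber sys s B ->
    iter n G h w - iter n G h w' <= 2 * (1 - (2 * m%:R)^-1) ^+ n * c.
Proof.
move=> sO c0 m0 [n0 n0m mix] hc.
set rho := 1 - _.
have m1 : 1 <= m%:R :> R by rewrite ler1n.
have v0 : 0 < (2 * m%:R)^-1 :> R by rewrite invr_gt0; lra.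
have v1 : (2 * m%:R)^-1 <= 2^-1 :> R by rewrite lef_pV2 ?posrE; lra.
have rho0 : 0 <= rho by rewrite /rho; lra.
have rho1 : rho <= 1 by rewrite /rho; lra.
have rhom : 1 <= 2 * rho ^+ m.
  have bern k : 1 - k%:R * (2 * m%:R)^-1 <= rho ^+ k.
    elim: k => [|k IH]; first by rewrite mul0r subr0 expr0.
    rewrite exprS; apply: (le_trans _ (ler_wpM2l rho0 IH)).
    rewrite /rho -natr1; set x := _^-1; have : 0 <= x by exact: ltW.
    by have : 0 <= k%:R :> R by []; nra.
  have : m%:R * (2 * m%:R)^-1 = 2^-1 :> R by field; lra.
  by have := bern m; lra.
elim/ltn_ind => n IH w w' ws w's.
have wO := block_fiber_conf ws.
have [nm|mn] := ltnP n m.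
  apply: (@le_trans _ _ c).
    by apply: iter_block_glauber_osc => //; rewrite (block_fiber_eq ws).
  rewrite -[leLHS]mul1r ler_wpM2r //; apply: (le_trans rhom).
  by rewrite ler_wpM2l // ler_wiXn2l // ltnW.
(* Of the [m] outermost steps, [n0] halve the oscillation by mixing and the surplus [m - n0] cannot
   increase it; the induction hypothesis controls the other [n - m]. *)
rewrite -(subnKC mn) iterD; set k := iter (n - m) G h.
have -> : iter m G k = iter n0 G (iter (m - n0) G k) by rewrite -iterD subnKC.
have n'n : (n - m < n)%N by rewrite ltn_subrL m0 (leq_trans m0 mn).
have c'0 : 0 <= 2 * rho ^+ (n - m) * c by rewrite !mulr_ge0 ?exprn_ge0.
apply: le_trans (mixed_osc sO mix ws w's c'0 _) _; last first.
  have := ler_wpM2r c'0 rhom; rewrite mul1r => H.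
  by rewrite subnKC // -[in leRHS](subnK mn) exprD; lra.
move=> u u' us u's; have uO := block_fiber_conf us.
apply: iter_block_glauber_osc => //; first by rewrite (block_fiber_eq us).
by move=> z z'; rewrite (block_fiber_eq us); exact: IH.
Qed.

(** By stationarity [block_op] averages the evolved [h] over the fiber, so the error is at most the
    oscillation of the evolved [h]. *)
Lemma iter_block_glauber_mix (m : nat) h c s : s \in Om -> 0 <= c -> (0 < m)%N ->
  (exists2 n, (n <= m)%N & mixed (glauber_on sys B) (block_fiber sys s B)
     (block_update sys B s) 4^-1 n) ->
  (forall w w', w \in block_fiber sys s B -> w' \in block_fiber sys s B ->
     h w - h w' <= c) ->
  forall n, `|iter n G h s - block_op B h s| <= 2 * (1 - (2 * m%:R)^-1) ^+ n * c.
Proof.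
move=> sO c0 m0 mix hc n; set D := _ * c.
have ss := block_fiber_refl B sO.
have H := block_osc_decay sO c0 m0 mix hc n.
rewrite -(block_op_stationary n h sO).
have -> : iter n G h s - block_op B (iter n G h) s
   = \sum_w block_update sys B s w * (iter n G h s - iter n G h w).
  under [RHS]eq_bigr do rewrite mulrBr.
  by rewrite sumrB -mulr_suml block_update_sum // mul1r.
apply: (le_trans (ler_norm_sum _ _ _)).
rewrite -[leRHS]mul1r -(block_update_sum sO) mulr_suml; apply: ler_sum => w _.
have [ws|/block_update_out->] := boolP (w \in block_fiber sys s B); last first.
  by rewrite !mul0r normr0.
rewrite normrM ger0_norm ?block_update_ge0 // ler_wpM2l ?block_update_ge0 //.
by rewrite ler_norml H // andbT lerNl opprB H.
Qed.

End FixedBlock.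

(** * Locality under the Markov property *)

Section Locality.
Variable e : rel V.
Hypothesis mrf : markov_random_field sys e.

Definition local C h := forall s t, s \in Om -> t \in Om -> {in C, s =1 t} ->
  h s = h t.

(** The Markov property of a one-site block, whose fiber is the site fiber and whose marginal is the
    spin law. *)
Lemma spin_law_local v s t : s \in Om -> t \in Om ->
  {in boundary e [set v], s =1 t} -> spin_law sys s v =1 spin_law sys t v.
Proof.
move=> sO tO st a; have := mrf sO tO st [ffun=> a].
have marg w : w \in Om ->
    block_marginal sys [set v] w [ffun=> a] = spin_law sys w v a.
  move=> wO; have fibE : block_fiber sys w [set v] = site_fiber sys w v.
    apply/setP => z; rewrite site_fiberE; apply/block_fiberP/andP => -[zO zw].
      split=> //; apply/eqP/ffunP => u; rewrite updE; case: eqP => [->//|/eqP uv].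
      by rewrite zw // inE.
    by split=> // u; rewrite inE => /negPf uv; rewrite (eqP zw) updE uv.
  rewrite /block_marginal /block_update fibE.
  have -> : spin_law sys w v a = site_op sys v (fun z => (z v == a)%:R) w.
    rewrite /site_op (bigD1 a) //= updE !eqxx mulr1 big1 ?addr0 //.
    by move=> b /negPf ba; rewrite updE eqxx ba mulr0.
  rewrite site_opE big_mkcond; apply: eq_bigr => z _.
  rewrite mulr_natr mulrb; congr (if _ then _ else _).
  apply/forall_inP/eqP => [/(_ v)|zv u]; rewrite inE ffunE.
    by rewrite eqxx => /(_ isT)/eqP.
  by move=> /eqP->; apply/eqP.
by rewrite !marg.
Qed.

Lemma site_op_local v C h : boundary e [set v] \subset C -> local C h ->
  local C (site_op sys v h).
Proof.
move=> bC hC s t sO tO st; apply: eq_bigr => a _.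
have pst : spin_law sys s v a = spin_law sys t v a.
  by apply: spin_law_local => // u /(fintype.subsetP bC); exact: st.
(* If one updated configuration is inadmissible, both of the equal spin laws vanish at [a]; locality
   of [h] is thus only used inside Omega. *)
have [uO|/spin_law_out s0] := boolP (upd s v a \in Om); last first.
  by rewrite -pst s0 !mul0r.
have [uO'|/spin_law_out t0] := boolP (upd t v a \in Om); last first.
  by rewrite pst t0 !mul0r.
rewrite pst; congr (_ * _); apply: hC => // u uC; rewrite !updE.
by case: eqP => // _; apply: st.
Qed.

Lemma iter_block_glauber_local B n h : local (B :|: boundary e B) h ->
  local (B :|: boundary e B) (iter n (block_glauber B) h).
Proof.
move=> hC; elim: n => //= n IH s t sO tO st; congr (_ * _).
apply: eq_bigr => v vB; apply: (site_op_local _ IH) => //.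
apply/fintype.subsetP => u; rewrite !inE => /andP[uv /existsP[x]].
rewrite inE => /andP[/eqP-> vu]; case: (boolP (u \in B)) => //= uB.
by apply/existsP; exists v; rewrite vB.
Qed.

End Locality.
End BlockChain.

(** * Simultaneous dynamics in separated blocks *)

Definition hamming_on (V S : finType) (B : {set V}) (s t : config V S) : nat :=
  #|[set v in B | s v != t v]|.

Definition patch (V S : finType) (B : {set V}) (x z : config V S) : config V S :=
  [ffun v => if v \in B then z v else x v].

Definition incr_at (I : eqType) (j : I) (k : I -> nat) (i : I) : nat :=
  (k i + (i == j))%N.

Section RandomCounts.
Variables (R : realFieldType) (I : finType) (p0 : R) (p : I -> R).
Hypotheses (p0_ge0 : 0 <= p0) (p_ge0 : forall i, 0 <= p i).
Hypothesis p_sum : p0 + \sum_i p i = 1.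

(** Transition operator of random counters: counter [i] advances with probability [p i], and none
    does with probability [p0]. *)
Definition count_op (psi : (I -> nat) -> R) (k : I -> nat) : R :=
  p0 * psi k + \sum_i p i * psi (incr_at i k).

(** As a function of [k], [rho ^+ k i] is an eigenfunction of [count_op] with eigenvalue
    [1 - p i * (1 - rho)], and constants are fixed. *)
Lemma iter_count_op_le (psi psi' : (I -> nat) -> R) (c rho : R) (b : I -> R) n k :
  (forall k, psi k - psi' k <= c + \sum_i b i * rho ^+ k i) ->
  iter n count_op psi k - iter n count_op psi' k
  <= c + \sum_i b i * (1 - p i * (1 - rho)) ^+ n * rho ^+ k i.
Proof.
move=> H; elim: n k => [|n IH] k /=.
  apply: (le_trans (H k)); rewrite lerD2l; apply: ler_sum => i _.
  by rewrite expr0 mulr1.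
have cE f k' : count_op f k' = p0 * f k' + \sum_i p i * f (incr_at i k') by [].
rewrite !cE opprD addrACA -mulrBr -sumrB.
apply: (@le_trans _ _ (p0 * (c + \sum_i b i * (1 - p i * (1 - rho)) ^+ n * rho ^+ k i)
  + \sum_j p j * (c + \sum_i b i * (1 - p i * (1 - rho)) ^+ n * rho ^+ incr_at j k i))).
  by apply: lerD; [|apply: ler_sum => j _; rewrite -mulrBr]; rewrite ler_wpM2l.
set T := fun j i => b i * (1 - p i * (1 - rho)) ^+ n * rho ^+ incr_at j k i.
have -> : \sum_j p j * (c + \sum_i T j i)
    = (\sum_j p j) * c + \sum_i \sum_j p j * T j i.
  rewrite mulr_suml exchange_big -big_split; apply: eq_bigr => j _ /=.
  by rewrite mulrDr mulr_sumr.
rewrite mulrDr addrACA -mulrDl p_sum mul1r lerD2l mulr_sumr -big_split.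
rewrite le_eqVlt; apply/orP; left; apply/eqP.
apply: eq_bigr => i _ /=; rewrite /T {T}; set A := b i * _.
have -> : \sum_j p j * (A * rho ^+ incr_at j k i)
   = A * rho ^+ k i * (1 - p0 - p i * (1 - rho)).
  have ps : \sum_(j | j != i) p j = 1 - p0 - p i.
    by have := p_sum; rewrite (bigD1 i) //= => <-; ring.
  rewrite (bigD1 i) //= /incr_at eqxx addn1 exprS.
  rewrite (eq_bigr (fun j => A * rho ^+ k i * p j)) => [|j /negPf].
    by rewrite -mulr_sumr ps; ring.
  by rewrite eq_sym => ->; rewrite addn0; ring.
by rewrite exprS /A; ring.
Qed.

End RandomCounts.

Section ParallelBlocks.
Variables (R : realType) (V S : finType) (sys : spin_system R V S) (e : rel V).
Hypothesis mrf : markov_random_field sys e.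
Variables (I : finType) (B : I -> {set V}).
Hypothesis B0 : forall i, (0 < #|B i|)%N.
Let C i := B i :|: boundary e (B i).
Hypothesis sep : forall i j, i != j -> [disjoint B j & C i].
Implicit Types (x y z : config V S) (h : config V S -> R) (k : I -> nat).

Local Notation Om := (conf sys).
Local Notation pi := (prob sys).
Local Notation fn := (config V S -> R).
Local Notation G i := (block_glauber sys (B i)).

(* [resample h r k z x] is the expectation of h after resampling in x, independently,
   each block i of r from the law of k i steps of its dynamics started at z. The
   argument x need not be a configuration of Omega. *)
Fixpoint resample h (r : seq I) k z x : R :=
  if r is i :: r' then
    iter (k i) (G i) (fun w => resample h r' k z (patch (B i) x w)) z
  else h x.

Lemma eq_patch i x z z' : {in B i, z =1 z'} -> patch (B i) x z = patch (B i) x z'.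
Proof. by move=> zz; apply/ffunP => v; rewrite !ffunE; case: ifP => // /zz. Qed.

Lemma sub_closure i : B i \subset C i.
Proof. exact: finset.subsetUl. Qed.

Lemma patch_local i (F : fn) x n z z' : z \in Om -> z' \in Om -> {in C i, z =1 z'} ->
  iter n (G i) (fun w => F (patch (B i) x w)) z
  = iter n (G i) (fun w => F (patch (B i) x w)) z'.
Proof.
move=> zO z'O zz; apply: (iter_block_glauber_local mrf) => // w w' _ _ ww.
by rewrite (@eq_patch i x w w') // => v /(fintype.subsetP (sub_closure i))/ww.
Qed.

Lemma resample_local h r k z z' x : z \in Om -> z' \in Om ->
  (forall i, i \in r -> {in C i, z =1 z'}) ->
  resample h r k z x = resample h r k z' x.
Proof.
move=> zO z'O; elim: r x => //= i r IH x zz.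
have -> : (fun w => resample h r k z (patch (B i) x w))
        = (fun w => resample h r k z' (patch (B i) x w)).
  by apply/funext => w; apply: IH => j jr; apply: zz; rewrite inE jr orbT.
by apply: patch_local => //; apply: zz; rewrite mem_head.
Qed.

Lemma eq_resample_base h r k z x y :
  (forall v, (forall i, i \in r -> v \notin B i) -> x v = y v) ->
  resample h r k z x = resample h r k z y.
Proof.
elim: r x y => [|i r IH] x y xy /=.
  by congr h; apply/ffunP => v; apply: xy.
suff -> : (fun w => resample h r k z (patch (B i) x w))
        = (fun w => resample h r k z (patch (B i) y w)) by [].
apply/funext => w; apply: IH => v vr; rewrite !ffunE; case: ifP => // vi.
apply: xy => j; rewrite inE => /orP[/eqP->|]; [by rewrite vi | exact: vr].
Qed.

Lemma eq_resample_count h r k k' z x : {in r, k =1 k'} ->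
  resample h r k z x = resample h r k' z x.
Proof.
elim: r x => //= i r IH x kk; rewrite kk ?mem_head //.
suff -> : (fun w => resample h r k z (patch (B i) x w))
        = (fun w => resample h r k' z (patch (B i) x w)) by [].
by apply/funext => w; apply: IH => j jr; apply: kk; rewrite inE jr orbT.
Qed.

Lemma block_fiber_closure i j z w : i != j -> w \in block_fiber sys z (B j) ->
  {in C i, w =1 z}.
Proof.
move=> ij /block_fiberP[_ wz] v vC; apply: wz.
apply: contraL vC => vB; by rewrite (disjointFr (sep ij) vB).
Qed.

(** An extra step in block [j] is absorbed into its counter. If [j] heads the list, it joins the
    steps already made there; otherwise it commutes with the dynamics of the head [i], since the
    closure of [B i] avoids [B j]. *)
Lemma resample_incr h r k z x j : uniq r -> j \in r -> z \in Om ->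
  G j (fun w => resample h r k w x) z = resample h r (incr_at j k) z x.
Proof.
elim: r x => //= i r IH x /andP[ir ur] jr zO.
have [eij|nij] := eqVneq i j.
  have jr' : j \notin r by rewrite -eij.
  rewrite -eij in jr jr' *; rewrite /incr_at eqxx addn1 iterS.
  apply: (@eq_iter_block_glauber _ _ _ _ _ 1) => // w wz.
  have wO := block_fiber_conf wz.
  suff -> : (fun w' => resample h r k w (patch (B i) x w'))
          = (fun w' => resample h r (fun i0 => (k i0 + (i0 == i))%N) z
                         (patch (B i) x w')) by [].
  apply/funext => w'; rewrite -(@resample_local h r _ w z) //.
    apply: eq_resample_count => i' i'r; have [e'|] := eqVneq i' i.
      by rewrite e' (negPf ir) in i'r.
    by rewrite addn0.
  move=> i' i'r; apply: (block_fiber_closure _ wz).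
  by apply: contraNneq ir => <-.
have {}jr : j \in r by move: jr; rewrite inE eq_sym (negPf nij).
have kE : incr_at j k i = k i by rewrite /incr_at (negPf nij) addn0.
rewrite kE.
transitivity (G j (fun w => iter (k i) (G i)
    (fun w' => resample h r k w (patch (B i) x w')) z) z).
  apply: (@eq_iter_block_glauber _ _ _ _ _ 1) => // w wz.
  have wO := block_fiber_conf wz.
  apply: (patch_local (fun y => resample h r k w y)) => //.
  exact: block_fiber_closure wz.
(* Both chains now start at [z], so exchanging them only exchanges two finite sums. *)
transitivity (iter (k i) (G i)
    (fun w' => G j (fun w => resample h r k w (patch (B i) x w')) z) z).
  rewrite [RHS]iter_block_glauberE.
  rewrite -[LHS]/(iter 1 (G j) _ z) [LHS]iter_block_glauberE.
  under eq_bigr do rewrite iter_block_glauberE mulr_sumr.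
  rewrite exchange_big; apply: eq_bigr => w _.
  rewrite -[X in _ = _ * X]/(iter 1 (G j) _ z) iter_block_glauberE mulr_sumr.
  by apply: eq_bigr => w' _; rewrite mulrCA.
suff -> : (fun w' => G j (fun w => resample h r k w (patch (B i) x w')) z)
        = (fun w' => resample h r (incr_at j k) z (patch (B i) x w')) by [].
by apply/funext => w'; apply: IH.
Qed.

Let F := \bigcup_i B i.
Let psi h z k := resample h (enum I) k z z.
Let p i : R := #|B i|%:R / #|V|%:R.
Let p0 : R := #|~: F|%:R / #|V|%:R.

(** The base point moves with [w] too, but only inside [B j], which [resample] overwrites. *)
Lemma psi_incr h k z j : z \in Om ->
  G j (fun w => psi h w k) z = psi h z (incr_at j k).
Proof.
move=> zO; rewrite /psi -(@resample_incr h (enum I)) ?enum_uniq ?mem_enum //.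
apply: (@eq_iter_block_glauber _ _ _ _ _ 1) => // w /block_fiberP[_ wz].
by apply: eq_resample_base => v /(_ j); rewrite mem_enum => /(_ isT); exact: wz.
Qed.

Lemma disjoint_blocks i j : i != j -> [disjoint B i & B j].
Proof.
move=> ij; rewrite disjoint_sym.
exact: disjointWr (sub_closure i) (sep ij).
Qed.

Lemma censored_blocks h z :
  censored sys F h z = p0 * h z + \sum_i p i * G i h z.
Proof.
rewrite /censored /avg_op (bigID (mem F)) /=.
rewrite (eq_bigr (fun v => site_op sys v h z)) => [|v ->] //.
rewrite partition_disjoint_bigcup /=; last exact: disjoint_blocks.
rewrite [X in _ + X](eq_bigr (fun=> h z)) => [|v /negPf->] //.
rewrite sumr_const mulrDr addrC; congr (_ + _).
  rewrite -[h z *+ _]mulr_natl mulrA [_^-1 * _]mulrC; congr (_%:R / _ * _).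
  by apply: eq_card => v; rewrite !inE.
rewrite mulr_sumr; apply: eq_bigr => i _; rewrite /block_glauber /p mulrA.
congr (_ * _); rewrite mulrAC divff ?mul1r // pnatr_eq0.
by rewrite -lt0n.
Qed.

Lemma iter_censored_comb n c h (F' : I -> fn) (q : I -> R) z : z \in Om ->
  iter n (censored sys F) (fun w => c * h w + \sum_i q i * F' i w) z
  = c * iter n (censored sys F) h z + \sum_i q i * iter n (censored sys F) (F' i) z.
Proof.
elim: n z => //= n IH z zO; rewrite (eq_censored _ IH) // censoredD censoredZ.
congr (_ + _); rewrite /censored /avg_op [in RHS]/=.
under [RHS]eq_bigr do rewrite mulrCA.
rewrite -[RHS]mulr_sumr; congr (_ * _).
under [RHS]eq_bigr do rewrite mulr_sumr.
rewrite exchange_big; apply: eq_bigr => v _.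
by case: ifP => // _; rewrite site_op_sum.
Qed.

(* The censored chain only matters through the random numbers k i of updates
   received by the blocks, which evolve under [count_op]. *)
Lemma iter_censored_count n h k z : z \in Om ->
  iter n (censored sys F) (fun w => psi h w k) z
  = iter n (count_op p0 p) (psi h z) k.
Proof.
elim: n k => // n IH k zO.
rewrite iterSr (@eq_iter_censored _ _ _ _ _ _ _
  (fun w => p0 * psi h w k + \sum_i p i * psi h w (incr_at i k))) //; last first.
  move=> w wO; rewrite censored_blocks; congr (_ + _); apply: eq_bigr => i _.
  by rewrite psi_incr.
rewrite iter_censored_comb // IH //; congr (_ + _).
by apply: eq_bigr => i _; rewrite IH.
Qed.

Lemma iter_censoredE n h z : z \in Om ->
  iter n (censored sys F) h z = iter n (count_op p0 p) (psi h z) (fun=> 0%N).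
Proof.
move=> zO; rewrite -iter_censored_count //; apply: eq_iter_censored => // w wO.
rewrite /psi; have : forall x, (forall v, x v = w v) ->
  h w = resample h (enum I) (fun=> 0%N) w x; last by apply.
elim: (enum I) => [|i r IH] x xw /=; first by congr h; apply/ffunP.
by apply: IH => v; rewrite ffunE; case: ifP.
Qed.

End ParallelBlocks.

(** * Lipschitz constants and the Kantorovich distance *)

Section Hamming.
Variables (V S : finType).
Implicit Types (s t w : config V S) (B : {set V}).

Lemma hammingss s : hamming s s = 0%N.
Proof. by apply: eq_card0 => v; rewrite !inE eqxx. Qed.

Lemma hamming_triangle s t w : (hamming s w <= hamming s t + hamming t w)%N.
Proof.
apply: leq_trans (leq_card_setU _ _); apply: subset_leq_card.
by apply/fintype.subsetP => v; rewrite !inE; case: (s v =P t v) => //= ->.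
Qed.

Lemma hamming_on_split B s t :
  hamming s t = (hamming_on B s t + hamming_on (~: B) s t)%N.
Proof.
rewrite /hamming -(cardsID B); congr (_ + _)%N; apply: eq_card => v.
  by rewrite !inE andbC.
by rewrite !inE.
Qed.

Lemma hamming_on_le B s t : (hamming_on B s t <= #|B|)%N.
Proof. by apply: subset_leq_card; apply/fintype.subsetP => v; rewrite inE => /andP[]. Qed.

(* McShane's extension by an infimum. *)
Lemma lipschitz_extension (R : realType) (A : {set config V S}) (L : R)
    (h : config V S -> R) x0 : x0 \in A -> 0 <= L ->
  (forall s t, s \in A -> t \in A -> h s - h t <= L * (hamming s t)%:R) ->
  exists h' : config V S -> R, {in A, h =1 h'} /\
    forall s t, h' s - h' t <= L * (hamming s t)%:R.
Proof.
move=> x0A L0 hL.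
pose F s w := h w + L * (hamming s w)%:R.
have mP s : exists2 m, m \in A & forall w, w \in A -> F s m <= F s w.
  by have [m mA mmin] := arg_minP (F s) x0A; exists m.
exists (fun s => F s (s2val (cid2 (mP s)))); split.
  move=> s sA; case: (cid2 (mP s)) => m /= mA mmin; apply/eqP.
  rewrite eq_le; apply/andP; split; rewrite /F.
    by rewrite -lerBlDl hL.
  by have := mmin s sA; rewrite /F hammingss mulr0 addr0.
move=> s t; case: (cid2 (mP s)) => ms /= msA msP.
case: (cid2 (mP t)) => mt /= mtA mtP.
have := msP mt mtA; rewrite /F; have := hamming_triangle s t mt.
rewrite -(ler_nat R) natrD => /(ler_wpM2l L0).
by rewrite mulrDr; lra.
Qed.

End Hamming.

Section Kantorovich.
Variables (R : realType) (V S : finType) (sys : spin_system R V S).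
Implicit Types (s t w : config V S) (B : {set V}).
Local Notation Om := (conf sys).

Lemma kantorovich_ge (mu nu : config V S -> R) c :
  (forall s, 0 <= mu s) -> (forall s, 0 <= nu s) ->
  \sum_s mu s = 1 -> \sum_s nu s = 1 ->
  (forall q, is_coupling mu nu q -> c <= \sum_z q z * (hamming z.1 z.2)%:R) ->
  c <= kantorovich mu nu.
Proof.
move=> mu0 nu0 mu1 nu1 H; apply: lb_le_inf; last by move=> r [q [/H + ->]].
(* The product coupling shows that the set of costs is nonempty, as the lower bound on [inf]
   requires. *)
exists (\sum_z mu z.1 * nu z.2 * (hamming z.1 z.2)%:R).
exists (fun z => mu z.1 * nu z.2); split=> //; split=> [z|x|y] /=.
- exact: mulr_ge0.
- by rewrite -mulr_sumr nu1 mulr1.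
- by rewrite -mulr_suml mu1 mul1r.
Qed.

Lemma coupling_sum0 (mu nu : config V S -> R) (q : config V S * config V S -> R) z :
  is_coupling mu nu q -> (mu z.1 = 0 \/ nu z.2 = 0) -> q z = 0.
Proof.
case: z => s t [q0 q1 q2] /= [m0|n0]; apply/eqP; rewrite eq_le q0 andbT.
  by rewrite -m0 -q1 (bigD1 t) //= lerDl sumr_ge0.
by rewrite -n0 -q2 (bigD1 s) //= lerDl sumr_ge0.
Qed.

(** Off [B] the two samples keep the spins of [s] and [t], so every coupling pays the same
    deterministic cost there. *)
Lemma coupling_cost B s t q : s \in Om -> t \in Om ->
  is_coupling (block_update sys B s) (block_update sys B t) q ->
  \sum_z q z * (hamming z.1 z.2)%:R
  = \sum_z q z * (hamming_on B z.1 z.2)%:R + (hamming_on (~: B) s t)%:R.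
Proof.
move=> sO tO qC; set H := (hamming_on _ s t)%:R.
have q1 : \sum_z q z = 1.
  have [_ q1 _] := qC; rewrite -(block_update_sum B sO).
  under [RHS]eq_bigr do rewrite -q1.
  by rewrite pair_bigA; apply: eq_bigr => -[].
have -> : H = \sum_z q z * H by rewrite -mulr_suml q1 mul1r.
rewrite -big_split; apply: eq_bigr => -[w w'] _ /=.
have [wB|/block_update_out w0] := boolP (w \in block_fiber sys s B); last first.
  by rewrite (coupling_sum0 qC) ?mul0r ?addr0 //=; left.
have [w'B|/block_update_out w0] := boolP (w' \in block_fiber sys t B); last first.
  by rewrite (coupling_sum0 qC) ?mul0r ?addr0 //=; right.
rewrite -mulrDr (hamming_on_split B) natrD; congr (_ * (_ + _%:R)).
apply: eq_card => v; rewrite !inE.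
case: (boolP (v \in B)) => //= vB.
have /block_fiberP[_ ->] := wB => //.
by have /block_fiberP[_ ->] := w'B.
Qed.

Lemma kantorovich_block_ge B s t : s \in Om -> t \in Om ->
  (hamming_on (~: B) s t)%:R
  <= kantorovich (block_update sys B s) (block_update sys B t).
Proof.
move=> sO tO; apply: kantorovich_ge => [w|w|||q qC].
- exact: block_update_ge0.
- exact: block_update_ge0.
- exact: block_update_sum.
- exact: block_update_sum.
rewrite (coupling_cost sO tO qC) lerDr; apply: sumr_ge0 => z _.
by have [q0 _ _] := qC; rewrite mulr_ge0.
Qed.

Lemma block_op_lipschitz B s t (L : R) (h : config V S -> R) :
  s \in Om -> t \in Om -> 0 <= L ->
  (forall w w', h w - h w' <= L * (hamming_on B w w')%:R) ->
  block_op sys B h s - block_op sys B h t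
  <= L * (kantorovich (block_update sys B s) (block_update sys B t)
          - (hamming_on (~: B) s t)%:R).
Proof.
move=> sO tO L0 hL; rewrite mulrBr lerBrDr.
have key q : is_coupling (block_update sys B s) (block_update sys B t) q ->
    block_op sys B h s - block_op sys B h t + L * (hamming_on (~: B) s t)%:R
    <= L * \sum_z q z * (hamming z.1 z.2)%:R.
  move=> qC; rewrite (coupling_cost sO tO qC) mulrDr lerD2r.
  have [q0 q1 q2] := qC; rewrite /block_op.
  under eq_bigr do rewrite -q1 mulr_suml.
  under [X in _ - X <= _]eq_bigr do rewrite -q2 mulr_suml.
  rewrite [X in _ - X]exchange_big -sumrB.
  under eq_bigr do rewrite -sumrB.
  rewrite pair_bigA mulr_sumr; apply: ler_sum => -[w w'] _ /=.
  by rewrite -mulrBr mulrCA ler_wpM2l // hL.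
have [L_eq0|Lpos] := eqVneq L 0; last first.
  have {}Lpos : 0 < L by rewrite lt_neqAle eq_sym Lpos.
  rewrite -ler_pdivrMl //.
  apply: kantorovich_ge => [w|w|||q qC].
  - exact: block_update_ge0.
  - exact: block_update_ge0.
  - exact: block_update_sum.
  - exact: block_update_sum.
  by rewrite ler_pdivrMl // key.
pose q (z : config V S * config V S) :=
  block_update sys B s z.1 * block_update sys B t z.2.
have /key : is_coupling (block_update sys B s) (block_update sys B t) q.
  split=> [z|x|y]; rewrite /q /=.
  - by rewrite mulr_ge0 // block_update_ge0.
  - by rewrite -mulr_sumr block_update_sum // mulr1.
  - by rewrite -mulr_suml block_update_sum // mul1r.
by rewrite L_eq0 !mul0r.
Qed.

End Kantorovich.

(** * Lipschitz bounds for simultaneous block dynamics *)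

Section ParallelLipschitz.
Variables (R : realType) (V S : finType) (sys : spin_system R V S) (e : rel V).
Hypothesis mrf : markov_random_field sys e.
Variables (I : finType) (B : I -> {set V}).
Hypothesis B0 : forall i, (0 < #|B i|)%N.
Let C i := B i :|: boundary e (B i).
Hypothesis sep : forall i j, i != j -> [disjoint B j & C i].
Implicit Types (x y z : config V S) (h : config V S -> R) (k : I -> nat).

Local Notation Om := (conf sys).
Local Notation G i := (block_glauber sys (B i)).

Let off (r : seq I) x y := #|[set v | (x v != y v) && all (fun i => v \notin B i) r]|.

(** One block at a time: the start of the head chain moves from [z] to [z'] at cost [L * W i], then
    the function it acts on is changed by the induction hypothesis. Discrepancies of the bases
    inside the blocks are overwritten, so only [off] counts. *)
Lemma resample_lipschitz (L : R) h r k (W : I -> R) z z' :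
  0 <= L -> (forall x y, h x - h y <= L * (hamming x y)%:R) ->
  z \in Om -> z' \in Om ->
  (forall i (phi : config V S -> R), i \in r ->
     (forall w w', phi w - phi w' <= L * (hamming_on (B i) w w')%:R) ->
     iter (k i) (G i) phi z - iter (k i) (G i) phi z' <= L * W i) ->
  forall x y, resample sys B h r k z x - resample sys B h r k z' y
              <= L * ((off r x y)%:R + \sum_(i <- r) W i).
Proof.
move=> L0 hL; elim: r W z z' => [|i r IH] W z z' zO z'O HW x y.
  rewrite big_nil addr0 /=; apply: le_trans (hL _ _) _.
  rewrite ler_wpM2l // ler_nat; apply: subset_leq_card.
  by apply/fintype.subsetP => v; rewrite !inE andbT.
rewrite /= big_cons.
set phi := fun w => resample sys B h r k z (patch (B i) x w).
set phi' := fun w => resample sys B h r k z' (patch (B i) y w).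
have phiL w w' : phi w - phi w' <= L * (hamming_on (B i) w w')%:R.
  have := IH (fun=> 0) z z zO zO.
  rewrite big1 // => /(_ _ (patch (B i) x w) (patch (B i) x w')) H.
  apply: le_trans (H _) _ => [j f jr fL|]; first by rewrite subrr mulr0.
  rewrite addr0 ler_wpM2l // ler_nat; apply: subset_leq_card.
  apply/fintype.subsetP => v; rewrite !inE !ffunE.
  by case: ifP => _; [move=> /andP[->] | rewrite eqxx].
have H1 : iter (k i) (G i) phi z - iter (k i) (G i) phi z' <= L * W i.
  by apply: HW => //; rewrite mem_head.
have H2 : iter (k i) (G i) phi z' - iter (k i) (G i) phi' z'
    <= L * ((off (i :: r) x y)%:R + \sum_(j <- r) W j).
  rewrite -iter_block_glauberB -[leRHS](iter_block_glauber_cst (B0 i) (k i) _ z'O).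
  apply: iter_block_glauber_le => // w _; apply: le_trans (IH W _ _ _ _ _ _ _) _ => //.
    by move=> j f jr; apply: HW; rewrite inE jr orbT.
  rewrite ler_wpM2l // lerD2r ler_nat; apply: subset_leq_card.
  apply/fintype.subsetP => v; rewrite !inE !ffunE /=.
  case: ifP => vB; first by rewrite eqxx.
  by move=> /andP[-> ->].
by move: H1 H2; rewrite !mulrDr; lra.
Qed.

Variable m : nat.
Hypothesis m0 : (0 < m)%N.
Hypothesis mix : forall i w, w \in Om -> exists2 n, (n <= m)%N &
  mixed (glauber_on sys (B i)) (block_fiber sys w (B i))
     (block_update sys (B i) w) 4^-1 n.

Let rho : R := 1 - (2 * m%:R)^-1.
Let touch i z z' := [exists v in C i, z v != z' v].

(** Agreement on the closed block makes the left side 0 by locality. Otherwise both evolutions are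
    replaced by block updates, each at the cost of [2 * rho ^+ n] times the oscillation
    [L * #|B i|%:R], hence the 4. *)
Lemma block_glauber_lipschitz i n (phi : config V S -> R) (L : R) z z' :
  0 <= L -> z \in Om -> z' \in Om ->
  (forall w w', phi w - phi w' <= L * (hamming_on (B i) w w')%:R) ->
  iter n (G i) phi z - iter n (G i) phi z'
  <= L * (kantorovich (block_update sys (B i) z) (block_update sys (B i) z')
          - (hamming_on (~: B i) z z')%:R
          + (touch i z z')%:R * (4 * #|B i|%:R) * rho ^+ n).
Proof.
move=> L0 zO z'O phiL.
have [ti|nti] := boolP (touch i z z'); last first.
  have -> : iter n (G i) phi z = iter n (G i) phi z'.
    apply: (iter_block_glauber_local mrf) => //.
      move=> w w' _ _ ww; apply/eqP; rewrite eq_le.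
      have H0 (u u' : config V S) : {in B i, u =1 u'} -> phi u <= phi u'.
        move=> uu; rewrite -subr_le0; apply: le_trans (phiL _ _) _.
        rewrite (_ : hamming_on _ _ _ = 0%N) ?mulr0 //; apply: eq_card0 => v.
        by rewrite !inE; case: (boolP (v \in B i)) => //= /uu ->; rewrite eqxx.
      by rewrite !H0 // => v vB; rewrite ww // inE vB.
    move=> v vC; apply/eqP; apply: contraNT nti => nv.
    by apply/existsP; exists v; rewrite vC.
  rewrite subrr !mul0r addr0 mulr_ge0 // subr_ge0; exact: kantorovich_block_ge.
rewrite mul1r mulrDr.
have osc s w w' : w \in block_fiber sys s (B i) -> w' \in block_fiber sys s (B i) ->
    phi w - phi w' <= L * #|B i|%:R.
  move=> _ _; apply: le_trans (phiL _ _) _.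
  by rewrite ler_wpM2l // ler_nat hamming_on_le.
have c0 : 0 <= L * #|B i|%:R by rewrite mulr_ge0.
have := iter_block_glauber_mix (B0 i) zO c0 m0 (mix i zO) (osc z) n.
have := iter_block_glauber_mix (B0 i) z'O c0 m0 (mix i z'O) (osc z') n.
have := block_op_lipschitz zO z'O L0 phiL.
rewrite !ler_norml -/rho => ? /andP[? ?] /andP[? ?].
lra.
Qed.

Lemma parallel_lipschitz (V0 : (0 < #|V|)%N) (L : R) h n z z' :
  0 <= L -> (forall x y, x \in Om -> y \in Om -> h x - h y <= L * (hamming x y)%:R) ->
  z \in Om -> z' \in Om ->
  iter n (censored sys (\bigcup_i B i)) h z
  - iter n (censored sys (\bigcup_i B i)) h z'
  <= L * ((hamming z z')%:R
     + \sum_i (kantorovich (block_update sys (B i) z) (block_update sys (B i) z')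
          - (hamming z z')%:R)
     + \sum_i (touch i z z')%:R * (4 * #|B i|%:R)
               * (1 - #|B i|%:R / #|V|%:R * (1 - rho)) ^+ n).
Proof.
move=> L0 hL zO z'O.
(* [resample] evaluates its function at patched configurations, which may lie off Omega. *)
have [h' [hh' h'L]] := lipschitz_extension zO L0 hL.
rewrite !(eq_iter_censored _ _ hh') // !(iter_censoredE mrf B0 sep) //.
pose W i := kantorovich (block_update sys (B i) z) (block_update sys (B i) z')
          - (hamming_on (~: B i) z z')%:R.
pose b i := L * ((touch i z z')%:R * (4 * #|B i|%:R)).
have cardE (P : pred V) : #|[set v | P v & v \in \bigcup_i B i]|
    = (\sum_i #|[set v in B i | P v]|)%N.
  rewrite -sum1_card (eq_bigl (fun v => (v \in \bigcup_i B i) && P v)); last first.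
    by move=> v; rewrite !inE andbC.
  rewrite big_mkcondr partition_disjoint_bigcup; last exact: disjoint_blocks sep.
  apply: eq_bigr => i _; rewrite -big_mkcondr -sum1_card.
  by apply: eq_bigl => v; rewrite !inE.
have psum : #|~: \bigcup_i B i|%:R / #|V|%:R + \sum_i #|B i|%:R / #|V|%:R = 1 :> R.
  rewrite -mulr_suml -mulrDl -natr_sum -natrD.
  have -> : (\sum_i #|B i| = #|\bigcup_i B i|)%N.
    rewrite (_ : \bigcup_i B i = [set v | true & v \in \bigcup_i B i]).
      rewrite (cardE xpredT); apply: eq_bigr => i _; apply: eq_card => v.
      by rewrite !inE andbT.
    by apply/setP => v; rewrite !inE.
  by rewrite addnC cardsC divff // pnatr_eq0 -lt0n.
(* The blocks being disjoint, a discrepancy lies in one block or in none; this trades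
   [hamming_on (~: B i)] for the full Hamming distance in the final bound. *)
have offE : (hamming z z' = off (enum I) z z' + \sum_i hamming_on (B i) z z')%N.
  rewrite -(cardE (fun v => z v != z' v)) addnC.
  rewrite /hamming -(cardsID (\bigcup_i B i)); congr (_ + _)%N; apply: eq_card => v.
    by rewrite !inE.
  rewrite !inE andbC; congr (_ && _); apply/idP/allP => [vF i _|H].
    by apply: contra vF => vi; apply/bigcupP; exists i.
  by apply/bigcupP => -[i _]; apply/negP/H; rewrite mem_enum.
apply: le_trans (iter_count_op_le (c := L * ((off (enum I) z z')%:R + \sum_i W i))
  (rho := rho) (b := b) _ _ psum _ _ _) _.
- by rewrite divr_ge0.
- by move=> i; rewrite divr_ge0.
- move=> k.
  have := resample_lipschitz (r := enum I) (k := k)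
    (W := fun i => W i + (touch i z z')%:R * (4 * #|B i|%:R) * rho ^+ k i)
    L0 h'L zO z'O.
  move=> /(_ _ z z') H; apply: le_trans (H _) _.
    move=> i phi _ phiL; exact: block_glauber_lipschitz.
  rewrite big_enum /= big_split /= addrA mulrDr lerD2l mulr_sumr.
  by apply: ler_sum => i _; rewrite /b !mulrA.
rewrite [leRHS]mulrDr lerD //; last first.
  by rewrite mulr_sumr; apply: ler_sum => i _; rewrite /b expr0 mulr1 !mulrA.
rewrite ler_wpM2l //.
have -> : \sum_i W i = \sum_i (kantorovich (block_update sys (B i) z)
    (block_update sys (B i) z') - (hamming z z')%:R) + \sum_i (hamming_on (B i) z z')%:R.
  rewrite -big_split; apply: eq_bigr => i _ /=.
  by rewrite /W (hamming_on_split (B i) z z') natrD; ring.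
set K := \sum_i (_ - _); rewrite [in leRHS]offE natrD natr_sum; lra.
Qed.

End ParallelLipschitz.

(** * Cubes in the torus *)

Lemma eq_modnS (m a b : nat) : a = b %[mod m] -> a.+1 = b.+1 %[mod m].
Proof. by move=> ab; rewrite -addn1 -modnDml ab modnDml addn1. Qed.

Section TorusGeometry.
Variables (d n l : nat).
Local Notation N := n.+1.
Local Notation torus := (torus d N).
Implicit Types (u v w x : torus).

Local Notation closed_cube v := (cube l v :|: boundary (@torus_adj d N) (cube l v)).

Lemma cubeP v u : reflect
  (forall i, exists2 k, (k < l)%N & u i = v i + k %[mod N]) (u \in cube l v).
Proof.
rewrite inE; apply: (iffP forallP) => H i.
  by have /existsP[k /eqP uk] := H i; exists k.
by have [k kl uk] := H i; apply/existsP; exists (Ordinal kl); apply/eqP.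
Qed.

Lemma torus_eq u v : (forall i, u i = v i %[mod N]) -> u = v.
Proof.
by move=> uv; apply/ffunP => i; apply/val_inj; have := uv i; rewrite !modn_small.
Qed.

Lemma cube_anchor v : (0 < l)%N -> v \in cube l v.
Proof. by move=> l0; apply/cubeP => i; exists 0%N => //; rewrite addn0. Qed.

Lemma card_family_le (p : nat) (f : 'I_d -> nat -> nat) (A : {set torus}) :
  (forall u, u \in A -> forall i, exists2 k, (k < p)%N & u i = f i k %[mod N]) ->
  (#|A| <= p ^ d)%N.
Proof.
move=> Af.
pose g (k : {ffun 'I_d -> 'I_p}) : torus := [ffun i => inZp (f i (k i))].
have -> : (p ^ d = #|{ffun 'I_d -> 'I_p}|)%N by rewrite card_ffun !card_ord.
apply: leq_trans (leq_imset_card g _).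
apply: subset_leq_card; apply/fintype.subsetP => u uA.
have [k kP] : exists k : {ffun 'I_d -> 'I_p}, forall i, u i = f i (k i) %[mod N].
  have H i : exists k : 'I_p, u i == f i k %[mod N].
    by have [k kp uk] := Af u uA i; exists (Ordinal kp); apply/eqP.
  by exists [ffun i => xchoose (H i)] => i; rewrite ffunE; apply/eqP/(xchooseP (H i)).
apply/imsetP; exists k => //; apply: torus_eq => i.
by rewrite ffunE /= kP modn_mod.
Qed.

Lemma card_cube_le v : (#|cube l v| <= l ^ d)%N.
Proof. by apply: (@card_family_le l (fun i k => (v i + k)%N)) => u /cubeP. Qed.

(** Offsets in a closed cube run from -1 to [l]; taking the successor of the coordinate makes them
    natural numbers. *)
Lemma closed_cube_coord v u : u \in closed_cube v ->
  forall i, exists2 k, (k < l.+2)%N & (u i).+1 = v i + k %[mod N].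
Proof.
move=> /finset.setUP[/cubeP uv|+] i.
  have [k kl uk] := uv i; exists k.+1; first by rewrite ltnS ltnW.
  by rewrite addnS; apply: eq_modnS.
rewrite inE => /andP[_ /existsP[x /andP[/cubeP xv /existsP[j /andP[xu /forallP xuE]]]]].
have [k kl xk] := xv i.
have [eij|nij] := eqVneq i j; last first.
  have /implyP/(_ nij)/eqP xu' := xuE i; exists k.+1; first by rewrite ltnS ltnW.
  by rewrite addnS -xu'; apply: eq_modnS.
rewrite -eij in xu; case/orP: xu => /eqP xu.
  by exists k; [rewrite ltnW // ltnW | rewrite -xu].
exists k.+2; first by rewrite !ltnS.
by rewrite !addnS; apply: eq_modnS; rewrite xu; apply: eq_modnS.
Qed.

Lemma card_closed_cube_anchors u :
  (#|[set v | u \in closed_cube v]| <= l.+2 ^ d)%N.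
Proof.
(* The term [N * l.+2] vanishes modulo [N] and is at least [k], so the subtraction is not
   truncated. *)
apply: (@card_family_le _ (fun i k => ((u i).+1 + (N * l.+2 - k))%N)) => v.
rewrite inE => /closed_cube_coord uv i; have [k kl uk] := uv i; exists k => //.
rewrite -modnDml uk modnDml -addnA subnKC.
  by rewrite addnC mulnC modnMDl.
by rewrite mulSn; apply: leq_trans (ltnW kl) (leq_addr _ _).
Qed.

(** This turns sums over the set [cubes] into sums over anchors. If [v i] were [v' i + k.+1],
    lowering it by one would give a site in the cube of [v'] but, as [l < N], not in that of [v]. *)
Lemma cube_inj : (l < N)%N -> (0 < l)%N -> injective (@cube d N l).
Proof.
move=> lN l0 v v' vv'.
have : v \in cube l v' by rewrite -vv' cube_anchor.
move=> /cubeP vP; apply: torus_eq => i.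
have [[|k] kl vk] := vP i; first by rewrite vk addn0.
exfalso.
pose u : torus := [ffun j => if j == i then inZp (v' i + k) else v j].
have : u \in cube l v'.
  apply/cubeP => j; rewrite ffunE; case: eqP => [->|_]; last exact: vP.
  by exists k; [exact: ltnW | rewrite /= modn_mod].
rewrite -vv' => /cubeP/(_ i)[k' k'l]; rewrite ffunE eqxx /= modn_mod.
rewrite -(modnDml (v i) k') vk modnDml -addnA => /eqP; rewrite eqn_modDl => /eqP H.
have : k + 0 = k + k'.+1 %[mod N] by rewrite addn0 H addSn addnS.
move=> /eqP; rewrite eqn_modDl mod0n modn_small //.
exact: leq_ltn_trans lN.
Qed.

(** * Lattices of separated cubes *)

Section Lattice.
Variables (q : nat).
Hypothesis Nq : N = (q * l.+1)%N.

Definition lattice_point (y : {ffun 'I_d -> 'I_q}) : torus :=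
  [ffun i => inZp (y i * l.+1)].

(** Modulo the spacing [l.+1] the lattice points cancel, so the offsets of a common site from the
    two anchors agree; then the lattice points agree in every coordinate. *)
Lemma lattice_sep w y y' : y != y' ->
  [disjoint cube l (w + lattice_point y')%R & closed_cube (w + lattice_point y)%R].
Proof.
move=> yy'; apply/pred0P => u; apply/negP => /= /andP[/cubeP uy' /closed_cube_coord uy].
case/eqP: yy'; apply/ffunP => i; apply/val_inj => /=.
have [k kl uk] := uy' i; have [k' k'l uk'] := uy i.
have shiftE z : (w + lattice_point z)%R i = w i + z i * l.+1 %[mod N].
  by rewrite !ffunE /= modn_mod modnDmr.
have lt (z : {ffun 'I_d -> 'I_q}) : (z i * l.+1 < N)%N.
  by rewrite Nq ltn_mul2r ltn_ord.
have H : y' i * l.+1 + k.+1 = y i * l.+1 + k' %[mod N].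
  apply/eqP; rewrite -(eqn_modDl (w i)) !addnA; apply/eqP.
  have uk2 : u i = w i + y' i * l.+1 + k %[mod N].
    by rewrite uk -modnDml shiftE modnDml.
  by rewrite addnS -(eq_modnS uk2) uk' -modnDml shiftE modnDml.
have dN : (l.+1 %| N)%N by rewrite Nq dvdn_mull.
have : k.+1 = k' %[mod l.+1].
  have /(congr1 (fun a => a %% l.+1)%N) := H.
  by rewrite !modn_dvdm // !modnMDl.
move=> kk'.
(* The extreme offset [k' = l.+1] has residue 0, unlike [k.+1], which lies between 1 and [l]. *)
have {kk'} kk' : k' = k.+1.
  move: kk'; rewrite modn_small //.
  move: k'l; rewrite ltnS leq_eqVlt => /orP[/eqP->|k'l].
    by rewrite modnn.
  by rewrite modn_small.
move: H; rewrite kk' => /eqP; rewrite eqn_modDr !modn_small ?lt //.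
by move=> /eqP/eqP; rewrite eqn_pmul2r // => /eqP ->.
Qed.

Lemma card_lattice : (#|{ffun 'I_d -> 'I_q}| * l.+1 ^ d = #|torus|)%N.
Proof. by rewrite !card_ffun !card_ord Nq expnMn. Qed.

Lemma sum_lattice (R : realType) (F : torus -> R) :
  \sum_(w : torus) \sum_(y : {ffun 'I_d -> 'I_q}) F (w + lattice_point y)%R
  = #|{ffun 'I_d -> 'I_q}|%:R * \sum_v F v.
Proof.
rewrite exchange_big /=.
rewrite (eq_bigr (fun=> \sum_v F v)) => [|y _]; last first.
  by rewrite [RHS](reindex_inj (addIr (lattice_point y))).
by rewrite sumr_const mulr_natl.
Qed.

End Lattice.
End TorusGeometry.

(** * Contraction of the censored scheme *)

(** The induction step is [(1 - x) * (1 + (k + 1) * x) <= 1 + k * x]. The resulting bound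
    [1 / (1 + k * x)] on the power is enough for the mixing error. *)
Lemma bernoulli_inv (R : realFieldType) (x : R) k :
  0 <= x <= 1 -> (1 - x) ^+ k * (1 + k%:R * x) <= 1.
Proof.
move=> /andP[x0 x1]; elim: k => [|k IH]; first by rewrite expr0 mul0r addr0 mul1r.
apply: le_trans IH; rewrite exprSr -mulrA ler_wpM2l ?exprn_ge0 ?subr_ge0 //.
by rewrite -natr1; have : 0 <= k%:R :> R by []; nra.
Qed.

Section SchemeContraction.
Variables (R : realType) (S : finType) (d n l q : nat).
Local Notation N := n.+1.
Local Notation V := (torus d N).
Hypothesis l0 : (0 < l)%N.
Hypothesis Nq : N = (q * l.+1)%N.
Variable sys : spin_system R V S.
Hypothesis mrf : markov_random_field sys (@torus_adj d N).
Variable gamma : R.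
Hypothesis gamma0 : 0 < gamma.
Hypothesis contract : block_contracting l sys gamma.
Variable m : nat.
Hypothesis m0 : (0 < m)%N.
Hypothesis mix : forall v w, w \in conf sys -> exists2 t, (t <= m)%N &
  mixed (glauber_on sys (cube l v)) (block_fiber sys w (cube l v))
     (block_update sys (cube l v) w) 4^-1 t.

Local Notation Om := (conf sys).
Local Notation closed_cube v := (cube l v :|: boundary (@torus_adj d N) (cube l v)).
Implicit Types (z : config V S) (v w : V).

Let block w (y : {ffun 'I_d -> 'I_q}) := cube l (w + lattice_point n l y).
Let touch v z z' := [exists u in closed_cube v, z u != z' u].
Let kant v z z' := kantorovich (block_update sys (cube l v) z)
                               (block_update sys (cube l v) z').

Let V0 : (0 < #|V|)%N.
Proof. by rewrite card_ffun card_ord expn_gt0. Qed.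

(** Double counting: a discrepancy lies in at most [l.+2 ^ d] closed cubes. *)
Lemma sum_touch z z' :
  \sum_v (touch v z z')%:R <= (l.+2 ^ d)%:R * (hamming z z')%:R :> R.
Proof.
rewrite -natr_sum -natrM ler_nat /hamming.
apply: (@leq_trans (\sum_v \sum_(u in [set u | z u != z' u]) (u \in closed_cube v))).
  apply: leq_sum => v _; case: (boolP (touch v z z')) => // /existsP[u /andP[uv nu]].
  by rewrite (bigD1 u) /= ?uv // inE.
rewrite exchange_big mulnC -sum_nat_const; apply: leq_sum => u _.
apply: leq_trans (card_closed_cube_anchors l u).
rewrite -sum1_card [leqRHS]big_mkcond; apply: leq_sum => v _.
by rewrite inE; case: (_ \in _).
Qed.

Lemma sum_kantorovich_le z z' : z \in Om -> z' \in Om ->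
  \sum_v (kant v z z' - (hamming z z')%:R)
  <= - (gamma * (l ^ d)%:R * (hamming z z')%:R).
Proof.
move=> zO z'O; have lN : (l < N)%N.
  rewrite Nq; case: q Nq => [|q' _]; first by [].
  by rewrite mulSn ltn_addr.
have inj := cube_inj (d := d) lN l0.
have := contract zO z'O.
rewrite (card_imset _ inj) (big_imset _ (in2W inj)) /= => H.
have VR0 : 0 < #|V|%:R :> R by rewrite ltr0n.
have {H} := ler_wpM2l (ltW VR0) H; rewrite mulVKf ?gt_eqF // => H.
rewrite sumrB sumr_const -[X in _ - X]mulr_natl lerBlDr.
apply: le_trans H _; rewrite le_eqVlt; apply/orP; left; apply/eqP.
by field; rewrite gt_eqF.
Qed.

Let a0 : R := (2 * m%:R)^-1.
Variable K : nat.
Hypothesis K_large : 8 * (l.+2 ^ d)%:R <= gamma * (K%:R * a0).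

Definition cube_scheme := censoring_scheme sys (fun w => \bigcup_y block w y) (K * #|V|).

(** Anchors of a translated lattice have density [1 / l.+1 ^ d]; the 2 is there because half of the
    contraction is spent on incomplete mixing. *)
Let rate : R := 1 - gamma * (l ^ d)%:R / (2 * (l.+1 ^ d)%:R).

(** Averaged over the translates [w], [parallel_lipschitz] uses every anchor equally often, so
    [sum_kantorovich_le] bounds the gain and [sum_touch] the mixing error. *)
Lemma cube_scheme_contracts (L : R) h :
  0 <= L -> (forall z z', z \in Om -> z' \in Om -> h z - h z' <= L * (hamming z z')%:R) ->
  forall z z', z \in Om -> z' \in Om ->
    cube_scheme h z - cube_scheme h z' <= L * (rate * (hamming z z')%:R).
Proof.
move=> L0 hL z z' zO z'O.
set H := (hamming z z')%:R.
pose E : R := 4 * (l ^ d)%:R / (1 + K%:R * a0).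
have a0_gt0 : 0 < a0 by rewrite invr_gt0 mulr_gt0 ?ltr0n.
have a0_le1 : a0 <= 1.
  by rewrite invf_le1 ?mulr_gt0 ?ltr0n // -natrM ler1n muln_gt0.
have VR0 : 0 < #|V|%:R :> R by rewrite ltr0n.
have E1 : 0 < 1 + K%:R * a0 by rewrite ltr_pwDl // mulr_ge0 // ltW.
have cube1 v : 1 <= #|cube l v|%:R :> R.
  by rewrite ler1n; apply/card_gt0P; exists v; exact: cube_anchor.
(* A cube has at least one site, so the power is at most [(1 - a0 / #|V|%:R) ^+ (K * #|V|)], which
   [bernoulli_inv] bounds uniformly in [#|V|]. *)
have decay v : 4 * #|cube l v|%:R
    * (1 - #|cube l v|%:R / #|V|%:R * (1 - (1 - a0))) ^+ (K * #|V|) <= E.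
  rewrite opprB addrCA subrr addr0.
  have cV : #|cube l v|%:R <= #|V|%:R :> R by rewrite ler_nat max_card.
  have ratio : #|cube l v|%:R / #|V|%:R <= 1 :> R by rewrite ler_pdivrMr // mul1r.
  have ratio' : #|V|%:R^-1 <= #|cube l v|%:R / #|V|%:R :> R.
    by rewrite ler_peMl // invr_ge0.
  have V1 : 0 < #|V|%:R^-1 :> R by rewrite invr_gt0.
  have xle : 0 <= a0 / #|V|%:R <= 1.
    have V1' : #|V|%:R^-1 <= 1 :> R by rewrite invf_le1 // ler1n.
    by rewrite mulr_ge0 ?(ltW a0_gt0) ?(ltW V1) //= mulr_ile1 // ltW.
  have := bernoulli_inv (K * #|V|) xle.
  have -> : (K * #|V|)%:R * (a0 / #|V|%:R) = K%:R * a0.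
    by rewrite natrM; field; rewrite gt_eqF.
  rewrite -ler_pdivlMr // => bern.
  have x1 : #|cube l v|%:R / #|V|%:R * a0 <= 1.
    by rewrite mulr_ile1 // ?divr_ge0 // ltW.
  apply: ler_pM => //.
  - by rewrite mulr_ge0.
  - by rewrite exprn_ge0 // subr_ge0.
  - by rewrite ler_wpM2l // ler_nat card_cube_le.
  rewrite -[leRHS]mul1r; apply: le_trans _ bern; apply: lerXn2r.
  - by rewrite nnegrE subr_ge0.
  - by rewrite nnegrE subr_ge0; case/andP: xle.
  by rewrite lerD2l lerN2 mulrC ler_wpM2r // ltW.
have step : cube_scheme h z - cube_scheme h z' <= #|V|%:R^-1 * \sum_(w : V) (L * (H
   + \sum_(y : {ffun 'I_d -> 'I_q}) (kant (w + lattice_point n l y) z z' - H)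
   + \sum_(y : {ffun 'I_d -> 'I_q}) (touch (w + lattice_point n l y) z z')%:R * E)).
  rewrite /cube_scheme /censoring_scheme /avg_op -mulrBr -sumrB.
  rewrite ler_wpM2l ?invr_ge0 //; apply: ler_sum => w _.
  apply: le_trans (parallel_lipschitz mrf _ _ m0 _ V0 _ L0 hL zO z'O) _.
  - move=> y; apply/card_gt0P; exists (w + lattice_point n l y); exact: cube_anchor.
  - by move=> y y' yy'; exact: lattice_sep.
  - by move=> y w' w'O; exact: mix.
  rewrite ler_wpM2l // lerD2l; apply: ler_sum => y _.
  by rewrite -!mulrA ler_wpM2l // !mulrA decay.
apply: (le_trans step).
rewrite -mulr_sumr mulrCA ler_wpM2l //.
rewrite !big_split /= sumr_const.
rewrite (sum_lattice l q (fun v => kant v z z' - H)).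
rewrite (sum_lattice l q (fun v => (touch v z z')%:R * E)) -mulr_suml.
have cI : #|V|%:R = #|{ffun 'I_d -> 'I_q}|%:R * (l.+1 ^ d)%:R :> R.
  by rewrite -natrM (card_lattice d Nq).
have := sum_kantorovich_le zO z'O; rewrite -/H; set X := \sum_v _ => leX.
have := sum_touch z z'; rewrite -/H; set T := \sum_v _ => leT.
rewrite ler_pdivrMl // -[H *+ _]mulr_natl cI.
set Q : R := #|{ffun 'I_d -> 'I_q}|%:R in cI *; set LL : R := (l.+1 ^ d)%:R in cI *.
have LL0 : 0 < LL by rewrite ltr0n expn_gt0.
have -> : Q * LL * (rate * H) = Q * (LL * H - gamma * (l ^ d)%:R * H / 2).
  by rewrite /rate -/LL; field; rewrite gt_eqF.
rewrite -mulrA -!mulrDr ler_wpM2l //.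
have E0 : 0 <= E by rewrite divr_ge0 ?mulr_ge0 // ltW.
have TE : T * E <= (l.+2 ^ d)%:R * H * E by rewrite ler_wpM2r.
(* [K_large] is designed for this: the mixing error uses at most half of the contraction. *)
have DE : (l.+2 ^ d)%:R * E <= gamma * (l ^ d)%:R / 2.
  rewrite /E mulrA ler_pdivrMr // mulrA.
  have := ler_wpM2l (ler0n R (l ^ d)) K_large.
  have : 0 <= gamma * (l ^ d)%:R by rewrite mulr_ge0 // ltW.
  by move: (l ^ d)%:R (l.+2 ^ d)%:R (K%:R * a0) => u v w; lra.
have := ler_wpM2r (ler0n R (hamming z z')) DE; rewrite -/H => DEH.
have {}TE : T * E <= gamma * (l ^ d)%:R / 2 * H.
  by apply: le_trans TE _; rewrite mulrAC.
move: leX TE; move: (gamma * _) (T * E) => g te.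
lra.
Qed.

End SchemeContraction.

(** * From rounds to the mixing time *)

Lemma logarithmic_rounds (R : realType) (c s0 : R) : 0 <= c < 1 -> 0 < s0 ->
  exists2 alpha : R, 0 <= alpha & forall p : nat, (1 < p)%N ->
    exists2 r : nat, r%:R <= alpha * ln p%:R & c ^+ r * (s0 * p%:R) <= 1.
Proof.
move=> /andP[c0 c1] s0_gt0.
have ln2 : 0 < ln 2 :> R by rewrite ln_gt0 // ltr1n.
pose delta := 1 - c; have delta0 : 0 < delta by rewrite subr_gt0.
(* As [c] is at most the exponential of [- delta], the sum of [|ln s0|] and [ln p], divided by
   [delta], is a sufficient number of rounds; [ln 2 <= ln p] makes the constant term a multiple of
   [ln p]. *)
pose beta := (1 + `|ln s0| / ln 2) / delta.
have beta0 : 0 <= beta.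
  by rewrite divr_ge0 ?(ltW delta0) // addr_ge0 // divr_ge0 // ltW.
(* The term [(ln 2)^-1] contributes at least 1 and pays for rounding up. *)
exists (beta + (ln 2)^-1) => [|p p1]; first by rewrite addr_ge0 // invr_ge0 ltW.
have p2 : ln 2 <= ln p%:R :> R.
  by rewrite ler_ln ?posrE ?ltr0n ?ler_nat // ltnW.
have lnp0 : 0 <= ln p%:R :> R by apply: le_trans p2; exact: ltW.
have q1 : 1 <= (ln 2)^-1 * ln p%:R :> R by rewrite ler_pdivlMl // mulr1.
exists (Num.truncn (beta * ln p%:R)).+1.
  have := truncn_le (beta * ln p%:R); rewrite mulr_ge0 // => le.
  by rewrite -natr1 mulrDl lerD.
set r := _.+1.
have rP : beta * ln p%:R <= r%:R by apply/ltW/truncnS_gt.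
have dr : `|ln s0| + ln p%:R <= delta * r%:R.
  apply: le_trans (ler_wpM2l (ltW delta0) rP).
  have -> : delta * (beta * ln p%:R) = ln p%:R + `|ln s0| * ((ln 2)^-1 * ln p%:R).
    by rewrite /beta; field; rewrite !gt_eqF.
  by rewrite addrC lerD2l ler_peMr.
have cr : c ^+ r <= expR (- (delta * r%:R)).
  rewrite -mulNr expRM_natr; apply: lerXn2r; rewrite ?nnegrE ?expR_ge0 //.
  by apply: le_trans (expR_ge1Dx _); rewrite /delta opprB addrCA subrr addr0.
have p0 : 0 < p%:R :> R by rewrite ltr0n ltnW.
have sp0 : 0 < s0 * p%:R by rewrite mulr_gt0.
apply: le_trans (ler_wpM2r (ltW sp0) cr) _.
rewrite -[leRHS]expR0 -[s0 * _]lnK ?posrE // lnM ?posrE // -expRD ler_expR.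
by have := ler_norm (ln s0); lra.
Qed.

Lemma iter_lipschitz (R : realType) (V S : finType) (A : {set config V S})
    (T : (config V S -> R) -> config V S -> R) (c : R) : 0 <= c ->
  (forall L h, 0 <= L ->
     (forall s t, s \in A -> t \in A -> h s - h t <= L * (hamming s t)%:R) ->
     forall s t, s \in A -> t \in A -> T h s - T h t <= L * (c * (hamming s t)%:R)) ->
  forall r L h, 0 <= L ->
    (forall s t, s \in A -> t \in A -> h s - h t <= L * (hamming s t)%:R) ->
    forall s t, s \in A -> t \in A ->
      iter r T h s - iter r T h t <= L * c ^+ r * (hamming s t)%:R.
Proof.
move=> c0 TL; elim=> [|r IH] L h L0 hL s t sA tA /=.
  by rewrite expr0 mulr1 hL.
rewrite exprSr -2!mulrA mulrA; apply: TL => //.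
  by rewrite mulr_ge0 // exprn_ge0.
by move=> *; apply: IH.
Qed.

Lemma rank_sum_lipschitz (R : realType) (V : finType) (disp : Order.disp_t)
    (S : finOrderType disp) (s t : config V S) :
  rank_sum R s - rank_sum R t <= #|S|%:R * (hamming s t)%:R.
Proof.
rewrite /rank_sum -sumrB /hamming -sum1_card natr_sum mulr_sumr [leRHS]big_mkcond.
apply: ler_sum => v _; rewrite inE; case: eqP => [->|_] /=; first by rewrite subrr.
rewrite mulr1 lerBlDr -natrD ler_nat; apply: leq_trans (leq_addr _ _).
exact: max_card.
Qed.

Lemma hamming_le (V S : finType) (s t : config V S) : (hamming s t <= #|V|)%N.
Proof. exact: max_card. Qed.

Lemma mixing_time_exists (R : realType) (T : finType) (K : T -> T -> R)
    (A : {set T}) (mu : T -> R) (eps : R) n :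
  mixed K A mu eps n -> exists2 t, is_mixing_time K A mu eps t & (t <= n)%N.
Proof.
move=> mixn.
have ex : exists k, `[< mixed K A mu eps k >] by exists n; apply/asboolP.
case: (ex_minnP ex) => t /asboolP mixt tmin.
exists t; last by apply: tmin; apply/asboolP.
by split=> // t' mixt'; apply: tmin; apply/asboolP.
Qed.

Theorem theorem1p2 (R : realType) (d : nat) (hd : (1 <= d)%N)
    (disp : Order.disp_t) (S : finOrderType disp) (M : R)
    (eps : R) (heps0 : 0 < eps) (heps1 : eps < 1)
    (gamma : R) (hgamma : 0 < gamma) (l : nat) (hl : (1 <= l)%N) :
  exists C : R,
    forall (N : nat), (1 <= N)%N -> (l.+1 %| N)%N ->
    forall sys : spin_system R (torus d N) S,
      monotone_system sys ->
      markov_random_field sys (@torus_adj d N) ->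
      has_top_conf sys ->
      has_bottom_conf sys ->
      block_contracting l sys gamma ->
      (forall B, B \in cubes d N l -> forall w, w \in conf sys ->
         exists t : nat, block_mixing_time sys B w t /\ t%:R <= M) ->
      exists T : nat, glauber_mixing_time sys eps T /\
        T%:R <= C * (#|torus d N|%:R * ln (#|torus d N|%:R)).
Proof.
pose m := (Num.bound `|M|).+1.
pose a0 : R := (2 * m%:R)^-1.
have a0_gt0 : 0 < a0 by rewrite invr_gt0 mulr_gt0 ?ltr0n.
(* This choice achieves [K_large] without reference to [N], so [K] may enter the implied
   constant. *)
pose K := Num.bound (8 * (l.+2 ^ d)%:R / (gamma * a0)).
have K_large : 8 * (l.+2 ^ d)%:R <= gamma * (K%:R * a0).
  rewrite mulrCA -ler_pdivrMr ?mulr_gt0 //; apply/ltW/archi_boundP.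
  by rewrite divr_ge0 // mulr_ge0 // ltW.
pose rate : R := 1 - gamma * (l ^ d)%:R / (2 * (l.+1 ^ d)%:R).
(* [rate] is negative if [gamma] is large, whereas iterated Lipschitz constants need a nonnegative
   factor. *)
pose c : R := Num.max 2^-1 rate.
have c01 : 0 <= c < 1.
  rewrite /c le_max invr_ge0 ler0n /= gt_max; apply/andP; split.
    by rewrite invf_lt1 ?ltr1n.
  by rewrite /rate ltrBlDr ltrDl divr_gt0 ?mulr_gt0 // ltr0n expn_gt0 ?hl.
(* The 2 comes from [iter_censored_gap] and [#|S|] is a Lipschitz constant of [rank_sum]; adding 1
   ensures positivity. *)
have s0_gt0 : 0 < 2 * (#|S|%:R + 1) / eps by rewrite divr_gt0 // mulr_gt0 // ltr_wpDl.
have [alpha alpha0 rounds] := logarithmic_rounds c01 s0_gt0.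
exists (alpha * K%:R) => -[//|n] _ /dvdnP[q Nq] sys mono mrf [top topO topP]
  [bot botO botP] contract mixB.
have mix v w : w \in conf sys -> exists2 t, (t <= m)%N &
  mixed (glauber_on sys (cube l v)) (block_fiber sys w (cube l v))
     (block_update sys (cube l v) w) 4^-1 t.
  move=> wO; have Bv : cube l v \in cubes d n.+1 l by exact: imset_f.
  have [t [[tmix _] tM]] := mixB _ Bv w wO.
  exists t; last exact: (tmix).
  apply: ltnW; rewrite -(ltr_nat R); apply: le_lt_trans tM _.
  apply: le_lt_trans (ler_norm M) _.
  by apply: lt_le_trans (archi_boundP (normr_ge0 M)) _; rewrite ler_nat.
(* A positive multiple of [l.+1] is at least 2, so the logarithm of the volume is positive. *)
have V1 : (1 < #|torus d n.+1|)%N.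
  rewrite card_ffun !card_ord; apply: leq_trans (leq_pexp2l _ hd) => //.
  by rewrite expn1 Nq; case: q Nq => // q' _; rewrite mulSn ltn_addr.
have V0 := ltnW V1.
have [r rle rP] := rounds _ V1.
set p := #|torus d n.+1| in V0 V1 rle rP *.
pose A := cube_scheme l q sys K.
have scheme_lip (L : R) h : 0 <= L ->
    (forall s t, s \in conf sys -> t \in conf sys -> h s - h t <= L * (hamming s t)%:R) ->
    forall s t, s \in conf sys -> t \in conf sys ->
      A h s - A h t <= L * (c * (hamming s t)%:R).
  move=> L0 hL s t sO tO.
  apply: le_trans (cube_scheme_contracts hl Nq mrf hgamma contract (ltn0Sn _) mix
    K_large L0 hL sO tO) _.
  by rewrite ler_wpM2l // ler_wpM2r // le_max lexx orbT.
have [c0 c1] := andP c01.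
have gap := iter_lipschitz c0 scheme_lip r (ler0n _ #|S|)
  (fun s t _ _ => @rank_sum_lipschitz R _ _ S s t) topO botO.
have mixn : mixed (glauber sys) (conf sys) (prob sys) eps (r * (K * p)).
  move=> s sO; apply: glauber_tv_dist => // g g01 t tO.
  apply: le_trans (iter_censored_gap mono _ g01 topO topP botO botP sO tO) _.
  have fI : increasing sys (rank_sum R (S := S) (V := torus d n.+1)).
    by move=> u w _ _; exact: rank_sum_le.
  have := scheme_top_le mono (fun w : torus d n.+1 =>
    \bigcup_(y : {ffun 'I_d -> 'I_q}) cube l (w + lattice_point n l y))
    (K * p) V0 r topO topP fI.
  have := scheme_bot_ge mono (fun w : torus d n.+1 =>
    \bigcup_(y : {ffun 'I_d -> 'I_q}) cube l (w + lattice_point n l y))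
    (K * p) V0 r botO botP fI.
  rewrite -[censoring_scheme _ _ _]/A => bot_ge top_le.
  have Hp : #|S|%:R * c ^+ r * (hamming top bot)%:R <= #|S|%:R * c ^+ r * p%:R.
    by rewrite ler_wpM2l ?mulr_ge0 ?exprn_ge0 // ler_nat hamming_le.
  have small : 2 * (c ^+ r * p%:R * (#|S|%:R + 1)) <= eps.
    rewrite -[leRHS]mul1r -ler_pdivrMr //; apply: le_trans rP.
    by rewrite le_eqVlt; apply/orP; left; apply/eqP; field; rewrite gt_eqF.
  have crp : 0 <= c ^+ r * p%:R by rewrite mulr_ge0 ?exprn_ge0.
  apply: le_trans small; rewrite ler_wpM2l //.
  have -> : c ^+ r * p%:R * (#|S|%:R + 1) = #|S|%:R * c ^+ r * p%:R + c ^+ r * p%:R.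
    by ring.
  lra.
have [T Tmix Tle] := mixing_time_exists mixn.
exists T; split=> //.
apply: (@le_trans _ _ (r * (K * p))%:R); first by rewrite ler_nat.
rewrite !natrM.
have -> : alpha * K%:R * (p%:R * ln p%:R) = alpha * ln p%:R * (K%:R * p%:R) :> R by ring.
by rewrite ler_wpM2r // mulr_ge0.
Qed.
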